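(* Let $(\overline X,0)$ be a germ of a normal complex surface, and let $(X,0)\subset(\mathbb C^k,0)$ be a non-pinched complex surface germ whose normalization is given by $$n:(\overline X,0)\to(X,0)\subset(\mathbb C^k,0),\qquad p\mapsto(f_1(p),\dots,f_k(p)).$$ Let $F:=(f_1,\dots,f_k)$, a generating system of the ideal $I:=n^*(\mathfrak m)$, where $\mathfrak m$ denotes the maximal ideal of $\mathcal O_{X,0}$. Let $G=(f_1,\dots,f_k,g_1,\dots,g_r)$ be a completion of $F$, and consider the complex surface germ $(X_G,0)\subset(\mathbb C^{k+r},0)$ defined as the image of the map $$G:(\overline X,0)\to(X_G,0)\subset(\mathbb C^{k+r},0),\qquad p\mapsto(f_1(p),\dots,f_k(p),g_1(p),\dots,g_r(p)).$$ Then there exists a positive constant $K$ such that $$K\,\|d_pG(u)\|_{\mathbb C^{k+r}}\le\|u\|_{g_F}\le\|d_pG(u)\|_{\mathbb C^{k+r}}$$ for every $p\in\overline X\setminus\{0\}$ and every vector $u\in T_p\overline X$. In particular, the map $G$ is a bilipschitz homeomorphism between $(\overline X,0)$ endowed with the metric $g_F$ and $(X_G,0)\subset(\mathbb C^{k+r},0)$ endowed with its natural inner metric.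
   Context: Complex surface germs are reduced and irreducible; all assertions about points of a germ are for a sufficiently small representative. $(X,0)$ is non-pinched if its normalization $n$ is an immersion at every point of $\overline X\setminus\{0\}$. A generating system $F=(f_1,\dots,f_k)$ of an ideal $I$ of $\mathcal O_{\overline X,0}$ containing a power of the maximal ideal is semi-complete if $p\mapsto(f_1(p),\dots,f_k(p))$ is an immersion at every point of $\overline X\setminus\{0\}$. For such $F$, $g_F$ is the Riemannian metric on $\overline X\setminus\{0\}$ obtained by pulling back the Euclidean metric of $\mathbb C^k$ by this map; its induced arc-length distance is $d_F$. A completion of a semi-complete generating system $F=(f_1,\dots,f_k)$ of $I$ is a semi-complete generating system $G=(f_1,\dots,f_k,g_1,\dots,g_r)$ of $I$ containing $F$ such that: (i) for every element $g$ of $G$ there are $\lambda_1,\dots,\lambda_k\in\mathcal O_{\overline X,0}$ with $\mathrm dg=\lambda_1\mathrm df_1+\dots+\lambda_k\mathrm df_k$; (ii) the image of the map $G$ is a complex surface germ with an isolated singularity at the origin; (iii) the map $G$ is a homeomorphism onto its image and a modification (proper bimeromorphic morphism) of its image. The inner metric of a germ embedded in $\mathbb C^N$ is the arc-length distance induced by the ambient Euclidean metric. *)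

(* Defs.v *)
(* Complex analytic germs at the origin of C^n, where C = R[i] for R : realType.
   A germ is given by a set X : set 'rV[R[i]]_n; only X near 0 matters, and all
   conditions below are insensitive to what happens away from 0. *)
From HB Require Import structures.
From mathcomp Require Import all_boot all_order all_algebra.
From mathcomp Require Export complex.
From mathcomp Require Export all_classical all_reals all_analysis.
Set Implicit Arguments.
Unset Strict Implicit.
Unset Printing Implicit Defensive.
Import Order.TTheory GRing.Theory Num.Theory.
Import numFieldNormedType.Exports.
Local Open Scope ring_scope.
Local Open Scope classical_set_scope.

(* The topology of R[i] is that of its norm; derivatives over the field R[i] are
   complex derivatives. *)
#[warnings="-redundant-canonical-projection"]
HB.instance Definition _ (R : rcfType) := NormedModule.copy R[i] R[i]^o.

(* ** Holomorphic maps and analytic sets *)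

(* Complex differentiable with continuous differential, on a neighbourhood. *)
Definition holomorphic_at (R : realType) n (V : normedModType R[i])
    (f : 'rV[R[i]]_n -> V) (x : 'rV[R[i]]_n) : Prop :=
  \forall y \near x, differentiable f y /\
    forall u, {for y, continuous (fun z => 'd f z u)}.

Definition coord (R : realType) n k (F : 'rV[R[i]]_n -> 'rV[R[i]]_k) (j : 'I_k) :
    'rV[R[i]]_n -> R[i] := fun x => F x 0 j.

(* Near x, the set Z is the zero set of finitely many holomorphic functions. *)
Definition analytic_at (R : realType) n (Z : set 'rV[R[i]]_n) (x : 'rV[R[i]]_n)
    : Prop :=
  exists m (h : 'rV[R[i]]_n -> 'rV[R[i]]_m),
    holomorphic_at h x /\ \forall z \near x, Z z <-> h z = 0.

Definition eq_germ (R : realType) n (X Y : set 'rV[R[i]]_n) : Prop :=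
  \forall x \near (0 : 'rV[R[i]]_n), X x <-> Y x.

Definition irreducible_germ (R : realType) n (X : set 'rV[R[i]]_n) : Prop :=
  forall X1 X2 : set 'rV[R[i]]_n, analytic_at X1 0 -> analytic_at X2 0 ->
    eq_germ X (X1 `|` X2) -> eq_germ X X1 \/ eq_germ X X2.

(* Near p, the set X is an embedded 2-dimensional complex submanifold; phi is a
   local parametrization, and the last clause says that it is a homeomorphism
   onto an open subset of X. *)
Definition regular_at (R : realType) n (X : set 'rV[R[i]]_n) (p : 'rV[R[i]]_n)
    : Prop :=
  exists (D : set 'rV[R[i]]_2) (phi : 'rV[R[i]]_2 -> 'rV[R[i]]_n),
    [/\ open D /\ D 0, phi 0 = p,
        forall a, D a -> holomorphic_at phi a /\ injective ('d phi a),
        set_inj D phi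
      & forall D', open D' -> D' `<=` D ->
          exists W, open W /\ phi @` D' = X `&` W].

(* Reduced (a germ of sets), irreducible, and of dimension 2: the points where X
   is a 2-dimensional manifold are dense. *)
Definition surface_germ (R : realType) n (X : set 'rV[R[i]]_n) : Prop :=
  [/\ X 0, analytic_at X 0, irreducible_germ X
    & \forall x \near (0 : 'rV[R[i]]_n),
        X x -> closure [set y | X y /\ regular_at X y] x].

Definition isolated_singularity (R : realType) n (X : set 'rV[R[i]]_n) : Prop :=
  \forall x \near (0 : 'rV[R[i]]_n), X x -> x != 0 -> regular_at X x.

(* An element of O_{X,0} is represented by an ambient holomorphic function germ;
   two of them are equal in O_{X,0} when they agree on X near 0. *)
Definition eq_on_germ (R : realType) n (X : set 'rV[R[i]]_n)
    (a b : 'rV[R[i]]_n -> R[i]) : Prop :=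
  \forall x \near (0 : 'rV[R[i]]_n), X x -> a x = b x.

(* A fraction a / b of O_{X,0} satisfying a monic equation of degree m belongs to
   O_{X,0} (the equation is multiplied by b ^+ m). *)
Definition integrally_closed_germ (R : realType) n (X : set 'rV[R[i]]_n) : Prop :=
  forall m (c : 'I_m -> 'rV[R[i]]_n -> R[i]) (a b : 'rV[R[i]]_n -> R[i]),
    (forall i, holomorphic_at (c i) 0) ->
    holomorphic_at a 0 -> holomorphic_at b 0 ->
    ~ eq_on_germ X b (fun=> 0) ->
    eq_on_germ X
      (fun x => a x ^+ m + \sum_(i < m) c i x * a x ^+ i * b x ^+ (m - i))
      (fun=> 0) ->
    exists q : 'rV[R[i]]_n -> R[i], holomorphic_at q 0 /\ eq_on_germ X a (fun x => q x * b x).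

(* Normality forces the singularity to be isolated (Serre's R1 in dimension 2);
   this is recorded explicitly, because the manifold structure of X \ {0} is what
   gives a meaning to immersions and Riemannian metrics there. *)
Definition normal_surface_germ (R : realType) n (X : set 'rV[R[i]]_n) : Prop :=
  [/\ surface_germ X, integrally_closed_germ X & isolated_singularity X].

(* ** Tangent spaces and immersions *)

(* The common kernel of the differentials at p of the functions vanishing on X;
   at a regular point this is the tangent space of the manifold. *)
Definition tangent_space (R : realType) n (X : set 'rV[R[i]]_n)
    (p : 'rV[R[i]]_n) : set 'rV[R[i]]_n :=
  [set u | forall h : 'rV[R[i]]_n -> R[i], holomorphic_at h p ->
             (\forall x \near p, X x -> h x = 0) -> 'd h p u = 0].

Definition immersion_off0 (R : realType) n k (X : set 'rV[R[i]]_n)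
    (F : 'rV[R[i]]_n -> 'rV[R[i]]_k) : Prop :=
  \forall p \near (0 : 'rV[R[i]]_n), X p -> p != 0 ->
    forall u, tangent_space X p u -> 'd F p u = 0 -> u = 0.

(* ** Modifications, normalization *)

(* P holds for arbitrarily small representatives of X (and suitable ones of Y). *)
Definition on_small_representatives (R : realType) n k
    (X : set 'rV[R[i]]_n) (Y : set 'rV[R[i]]_k)
    (P : set 'rV[R[i]]_n -> set 'rV[R[i]]_k -> Prop) : Prop :=
  forall O : set 'rV[R[i]]_n, nbhs (0 : 'rV[R[i]]_n) O ->
    exists (W : set 'rV[R[i]]_n) (W' : set 'rV[R[i]]_k),
      [/\ open W /\ W 0, W `<=` O, open W' /\ W' 0 & P (X `&` W) (Y `&` W')].

(* f : A -> B is a proper surjective holomorphic map which is biholomorphic over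
   the complement of a nowhere dense analytic subset S of B with nowhere dense
   preimage (psi is the local inverse). *)
Definition modification (R : realType) n k (f : 'rV[R[i]]_n -> 'rV[R[i]]_k)
    (A : set 'rV[R[i]]_n) (B : set 'rV[R[i]]_k) : Prop :=
  [/\ forall x, A x -> holomorphic_at f x,
      f @` A = B,
      forall Q, Q `<=` B -> compact Q -> compact (A `&` f @^-1` Q)
    & exists S : set 'rV[R[i]]_k,
      [/\ S `<=` B /\ (forall y, B y -> analytic_at S y),
          B `<=` closure (B `\` S) /\ A `<=` closure (A `\` f @^-1` S),
          set_inj (A `\` f @^-1` S) f
        & forall y, B y -> ~ S y -> exists psi : 'rV[R[i]]_k -> 'rV[R[i]]_n,
            holomorphic_at psi y /\
            \forall z \near y, B z -> A (psi z) /\ f (psi z) = z]].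

(* Finite modification by a normal germ. *)
Definition normalization (R : realType) n k (Xbar : set 'rV[R[i]]_n)
    (X : set 'rV[R[i]]_k) (f : 'rV[R[i]]_n -> 'rV[R[i]]_k) : Prop :=
  [/\ normal_surface_germ Xbar, holomorphic_at f 0, f 0 = 0
    & on_small_representatives Xbar X (fun A B =>
        modification f A B /\ forall y, B y -> finite_set (A `&` f @^-1` [set y]))].

Definition homeomorphism (R : realType) n k (f : 'rV[R[i]]_n -> 'rV[R[i]]_k)
    (A : set 'rV[R[i]]_n) (B : set 'rV[R[i]]_k) : Prop :=
  [/\ {within A, continuous f}, f @` A = B
    & exists g : 'rV[R[i]]_k -> 'rV[R[i]]_n,
        {within B, continuous g} /\ forall x, A x -> g (f x) = x].

(* Y is the germ at 0 of the image by f of every small representative of X. *)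
Definition image_germ (R : realType) n k (X : set 'rV[R[i]]_n)
    (f : 'rV[R[i]]_n -> 'rV[R[i]]_k) (Y : set 'rV[R[i]]_k) : Prop :=
  exists O : set 'rV[R[i]]_n, nbhs (0 : 'rV[R[i]]_n) O /\
    forall W, nbhs (0 : 'rV[R[i]]_n) W -> W `<=` O -> eq_germ Y (f @` (X `&` W)).

(* ** Ideals of O_{X,0} *)

Definition ideal_generated (R : realType) n (X : set 'rV[R[i]]_n)
    (S : set ('rV[R[i]]_n -> R[i])) : set ('rV[R[i]]_n -> R[i]) :=
  [set a | holomorphic_at a 0 /\
    exists m (q s : 'I_m -> 'rV[R[i]]_n -> R[i]),
      (forall i, holomorphic_at (q i) 0 /\ S (s i)) /\
      eq_on_germ X a (fun x => \sum_(i < m) q i x * s i x)].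

Definition maximal_ideal (R : realType) n : set ('rV[R[i]]_n -> R[i]) :=
  [set h | holomorphic_at h 0 /\ h 0 = 0].

(* The ideal f^*(m) of O_{Xbar,0}. *)
Definition pullback_maximal_ideal (R : realType) n k (Xbar : set 'rV[R[i]]_n)
    (f : 'rV[R[i]]_n -> 'rV[R[i]]_k) : set ('rV[R[i]]_n -> R[i]) :=
  ideal_generated Xbar [set h \o f | h in @maximal_ideal R k].

Definition generating_system (R : realType) n k (X : set 'rV[R[i]]_n)
    (I : set ('rV[R[i]]_n -> R[i])) (F : 'rV[R[i]]_n -> 'rV[R[i]]_k) : Prop :=
  holomorphic_at F 0 /\ I = ideal_generated X (range (coord F)).

Definition contains_power_of_maximal_ideal (R : realType) n
    (I : set ('rV[R[i]]_n -> R[i])) : Prop :=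
  exists s, forall a : 'I_s -> 'rV[R[i]]_n -> R[i],
    (forall i, maximal_ideal (a i)) -> I (fun x => \prod_(i < s) a i x).

Definition semi_complete (R : realType) n k (X : set 'rV[R[i]]_n)
    (I : set ('rV[R[i]]_n -> R[i])) (F : 'rV[R[i]]_n -> 'rV[R[i]]_k) : Prop :=
  [/\ contains_power_of_maximal_ideal I, generating_system X I F
    & immersion_off0 X F].

(* The map (f_1, ..., f_k, g_1, ..., g_r). *)
Definition pair_map (R : realType) n k r (F : 'rV[R[i]]_n -> 'rV[R[i]]_k)
    (g : 'rV[R[i]]_n -> 'rV[R[i]]_r) : 'rV[R[i]]_n -> 'rV[R[i]]_(k + r) :=
  fun x => row_mx (F x) (g x).

(* (F, g) is a completion of F, and the germ XG is the image of (F, g).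
   Equality of 1-forms is required on the manifold X \ {0}. *)
Definition completion (R : realType) n k r (X : set 'rV[R[i]]_n)
    (I : set ('rV[R[i]]_n -> R[i])) (F : 'rV[R[i]]_n -> 'rV[R[i]]_k)
    (g : 'rV[R[i]]_n -> 'rV[R[i]]_r) (XG : set 'rV[R[i]]_(k + r)) : Prop :=
  let G := pair_map F g in
  [/\ semi_complete X I F /\ semi_complete X I G,
      forall j, exists lambda : 'I_k -> 'rV[R[i]]_n -> R[i],
        (forall i, holomorphic_at (lambda i) 0) /\
        \forall p \near (0 : 'rV[R[i]]_n), X p -> p != 0 ->
          forall u, tangent_space X p u ->
            'd (coord G j) p u = \sum_(i < k) lambda i p * 'd (coord F i) p u,
      image_germ X G XG,
      surface_germ XG /\ isolated_singularity XG
    & on_small_representatives X XG (fun A B =>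
        homeomorphism G A B /\ modification G A B)].

(* ** Lengths and distances *)

Definition enorm (R : realType) n (v : 'rV[R[i]]_n) : R :=
  Num.sqrt (\sum_(j < n) (complex.Re (v 0 j) ^+ 2 + complex.Im (v 0 j) ^+ 2)).

(* The norm on tangent vectors at p of the Riemannian metric g_F, pull-back by F
   of the Euclidean metric. *)
Definition pullback_norm (R : realType) n k (F : 'rV[R[i]]_n -> 'rV[R[i]]_k)
    (p u : 'rV[R[i]]_n) : R := enorm ('d F p u).

Definition path_in (R : realType) n (V : set 'rV[R[i]]_n) (p q : 'rV[R[i]]_n)
    : set (R -> 'rV[R[i]]_n) :=
  [set c : R -> 'rV[R[i]]_n |
    [/\ {within `[(0 : R), 1], continuous c}, c 0 = p, c 1 = q
      & forall t, `[0, 1] t -> V (c t)]].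

Definition velocity (R : realType) n (c : R -> 'rV[R[i]]_n) (t : R)
    : 'rV[R[i]]_n :=
  \row_j Complex ((fun s => complex.Re (c s 0 j))^`() t)
                 ((fun s => complex.Im (c s 0 j))^`() t).

Definition C1_curve (R : realType) n (c : R -> 'rV[R[i]]_n) : Prop :=
  (forall t j, derivable (fun s => complex.Re (c s 0 j)) t 1 /\
               derivable (fun s => complex.Im (c s 0 j)) t 1) /\
  continuous (velocity c).

(* On each closed interval of a subdivision of [a, b], the curve is the
   restriction of a C^1 curve. *)
Definition piecewise_C1 (R : realType) n (a b : R) (c : R -> 'rV[R[i]]_n) : Prop :=
  exists s : seq R, itv_partition a b s /\
    forall i, (i < size s)%N -> exists e : R -> 'rV[R[i]]_n, C1_curve e /\
      forall t, `[nth b (a :: s) i, nth b (a :: s) i.+1] t -> c t = e t.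

(* The arc-length distance of g_F on a representative V. The metric g_F lives on
   V \ {0}; a path through 0 is allowed when 0 is in V (this extends the distance
   to the origin): it is piecewise C^1 away from 0, and only its part in V \ {0}
   contributes to the length. If 0 is not in V, these are the piecewise C^1 paths
   and this is the usual Riemannian distance. Its value is +oo if there is no path
   of finite length. *)
Definition metric_length (R : realType) n k (F : 'rV[R[i]]_n -> 'rV[R[i]]_k)
    (c : R -> 'rV[R[i]]_n) : \bar R :=
  (\int[lebesgue_measure]_(t in `[0%R, 1%R] `&` [set s : R | (c s != 0)%R])
     (pullback_norm F (c t) (velocity c t))%:E)%E.

Definition metric_dist (R : realType) n k (F : 'rV[R[i]]_n -> 'rV[R[i]]_k)
    (V : set 'rV[R[i]]_n) (p q : 'rV[R[i]]_n) : \bar R :=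
  ereal_inf [set metric_length F c | c in
    [set c : R -> 'rV[R[i]]_n | path_in V p q c /\
       forall a b : R, 0 <= a -> a < b -> b <= 1 ->
         (forall t, `[a, b] t -> c t != 0) -> piecewise_C1 a b c]].

(* Length of a path for the Euclidean metric, as a supremum over subdivisions. *)
Definition arc_length (R : realType) n (c : R -> 'rV[R[i]]_n) : \bar R :=
  ereal_sup [set (\sum_(0 <= i < size s)
      enorm (c (nth 1 (0 :: s) i.+1) - c (nth 1 (0 :: s) i)))%:E
    | s in itv_partition 0 1].

(* The inner metric of V; +oo if there is no rectifiable path. *)
Definition inner_dist (R : realType) n (V : set 'rV[R[i]]_n)
    (x y : 'rV[R[i]]_n) : \bar R :=
  ereal_inf [set arc_length c | c in path_in V x y].

(* Main.v *)
Require Import Defs.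
From HB Require Import structures.
From mathcomp Require Import all_boot all_order all_algebra.
From mathcomp Require Import complex.
From mathcomp Require Import all_classical all_reals all_analysis.
From mathcomp Require Import measurable_realfun.
From mathcomp Require Import ring lra.
Set Implicit Arguments.
Unset Strict Implicit.
Unset Printing Implicit Defensive.
Import Order.TTheory GRing.Theory Num.Theory.
Import numFieldNormedType.Exports.
Import ComplexField.Normc.
Local Open Scope ring_scope.
Local Open Scope classical_set_scope.

(** The coefficients of the relations dG_j = sum_i lambda_ji dF_i are bounded near
    the origin, so that the norm of dG(u) is at most a constant times that of dF(u)
    for every tangent vector [u]. Conversely the coordinates of [F] are among those
    of [G]. This compares the norms; the distances follow by integration along
    paths, but they are defined in different ways. The distance of the metric g_F
    is an infimum of integrals of speeds, over paths that are piecewise C^1 away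
    from the origin, while the inner distance is an infimum of lengths of
    arbitrary continuous paths, given by inscribed polygonal lines. Moreover paths
    may go through the origin, where there is no tangent space, and may do so at a
    wild set of times.

    Upper bound for the inner distance ([arc_length_le_metric_length]). Let [c] be a
    path of the first kind. On an interval where [c] has no zero, the fundamental
    theorem of calculus bounds each chord of [G \o c] by the integral of the speed.
    On any other interval, [G \o c] takes the same value at the first and at the
    last zero of [c], and the chord is bounded by the two outer parts.

    Lower bound ([exists_short_path]). A path in the image of [G] is lifted to a
    continuous path [c0] by the inverse homeomorphism. The lift is replaced by a
    path of the first kind which is longer by a factor at most 1 + eps. Near a
    point other than the origin, the image by [G] of a segment in a chart is hardly
    longer than its chord ([chart_segments]), because [G] is an immersion there. By
    [cousin], such segments can be joined along any interval on which [c0] has no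
    zero ([close_curve_exists]). If [c0] has zeros, the time before the first zero
    and the time after the last one are exhausted by compact intervals
    ([close_curve_exhaustion]), and in between the new path stays at the origin
    ([short_path_zero]).

    Estimates use the Euclidean norm [enorm] and real radii throughout, and
    differentials of complex maps are applied to velocities of real curves through
    [has_velocity]. *)

(** * The Euclidean norm of C^n *)

Section EuclideanNorm.
Local Open Scope complex_scope.
Context {R : realType}.
Implicit Types (n : nat) (a : R[i]).

(** The real inner product on C^n = R^2n whose norm is [enorm]. Pairing with a
    fixed vector turns estimates on curves in C^n into estimates on real
    functions. *)
Definition rdot n (v w : 'rV[R[i]]_n) : R :=
  \sum_(j < n) (complex.Re (v 0 j) * complex.Re (w 0 j) +
                complex.Im (v 0 j) * complex.Im (w 0 j)).

Lemma rdotvv n (v : 'rV[R[i]]_n) : rdot v v = enorm v ^+ 2.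
Proof.
rewrite /enorm sqr_sqrtr; last first.
  by apply: sumr_ge0 => j _; rewrite addr_ge0// sqr_ge0.
by apply: eq_bigr => j _; rewrite !expr2.
Qed.

Lemma rdotC n (v w : 'rV[R[i]]_n) : rdot v w = rdot w v.
Proof. by apply: eq_bigr => j _; rewrite mulrC [X in _ + X]mulrC. Qed.

Lemma rdotDl n (u v w : 'rV[R[i]]_n) : rdot (u + v) w = rdot u w + rdot v w.
Proof.
rewrite /rdot -big_split; apply: eq_bigr => j _ /=; rewrite mxE.
by case: (u 0 j) => a b; case: (v 0 j) => c d /=; ring.
Qed.

Lemma rdotZl n (a : R) (v w : 'rV[R[i]]_n) :
  rdot (a%:C *: v) w = a * rdot v w.
Proof.
rewrite /rdot mulr_sumr; apply: eq_bigr => j _; rewrite mxE.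
by case: (v 0 j) => c d /=; ring.
Qed.

Lemma rdotNl n (v w : 'rV[R[i]]_n) : rdot (- v) w = - rdot v w.
Proof.
by rewrite -scaleN1r -[-1]/(-(1%:C)) -rmorphN rdotZl mulN1r.
Qed.

Lemma rdotBl n (u v w : 'rV[R[i]]_n) : rdot (u - v) w = rdot u w - rdot v w.
Proof. by rewrite rdotDl rdotNl. Qed.

Lemma rdotBr n (u v w : 'rV[R[i]]_n) : rdot w (u - v) = rdot w u - rdot w v.
Proof. by rewrite rdotC rdotBl !(rdotC w). Qed.

Lemma rdotZr n (a : R) (v w : 'rV[R[i]]_n) :
  rdot w (a%:C *: v) = a * rdot w v.
Proof. by rewrite rdotC rdotZl (rdotC w). Qed.

Lemma enorm_ge0 n (v : 'rV[R[i]]_n) : 0 <= enorm v.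
Proof. exact: sqrtr_ge0. Qed.

Lemma rdotvv_ge0 n (v : 'rV[R[i]]_n) : 0 <= rdot v v.
Proof. by rewrite rdotvv sqr_ge0. Qed.

Lemma normc_le_enorm n (v : 'rV[R[i]]_n) j : normc (v 0 j) <= enorm v.
Proof.
rewrite /enorm (bigD1 j)//=; case: (v 0 j) => a b /=.
rewrite ler_sqrt; last first.
  by rewrite addr_ge0// ?addr_ge0 ?sqr_ge0// sumr_ge0// => i _;
     rewrite addr_ge0 ?sqr_ge0.
by rewrite lerDl sumr_ge0// => i _; rewrite addr_ge0 ?sqr_ge0.
Qed.

Lemma enorm0 n : enorm (0 : 'rV[R[i]]_n) = 0.
Proof.
by rewrite /enorm big1 ?sqrtr0// => j _; rewrite mxE /= expr0n addr0.
Qed.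

Lemma enorm_eq0 n (v : 'rV[R[i]]_n) : enorm v = 0 -> v = 0.
Proof.
move=> v0; apply/rowP => j; rewrite mxE; apply: eq0_normc; apply: le_anti.
by rewrite -{1}v0 normc_le_enorm /=; case: (v 0 j) => a b /=; rewrite sqrtr_ge0.
Qed.

Lemma enorm_gt0 n (v : 'rV[R[i]]_n) : v != 0 -> 0 < enorm v.
Proof.
move=> v0; rewrite lt_neqAle enorm_ge0 andbT eq_sym.
by apply: contra v0 => /eqP/enorm_eq0 ->.
Qed.

Lemma enormZ n a (v : 'rV[R[i]]_n) : enorm (a *: v) = normc a * enorm v.
Proof.
rewrite /enorm; case: a => x y /=.
rewrite -sqrtrM ?addr_ge0 ?sqr_ge0// mulr_sumr; congr Num.sqrt.
by apply: eq_bigr => j _; rewrite mxE; case: (v 0 j) => c d /=; ring.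
Qed.

Lemma normcR (x : R) : normc x%:C = `|x|.
Proof. by rewrite /= expr0n addr0 sqrtr_sqr. Qed.

Lemma enormZR n (x : R) (v : 'rV[R[i]]_n) : enorm (x%:C *: v) = `|x| * enorm v.
Proof. by rewrite enormZ normcR. Qed.

Lemma enormN n (v : 'rV[R[i]]_n) : enorm (- v) = enorm v.
Proof. by rewrite -scaleN1r enormZ normcN normc1 mul1r. Qed.

Lemma enormBC n (v w : 'rV[R[i]]_n) : enorm (v - w) = enorm (w - v).
Proof. by rewrite -opprB enormN. Qed.

(** Cauchy-Schwarz: [v] minus its orthogonal projection on [w] has a nonnegative
    square. *)
Lemma rdot_le n (v w : 'rV[R[i]]_n) : rdot v w <= enorm v * enorm w.
Proof.
have [->|w0] := eqVneq w 0.
  by rewrite enorm0 mulr0 rdotC -(subrr v) rdotBl subrr.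
have e0 := enorm_gt0 w0.
pose s := rdot v w / enorm w ^+ 2.
have := rdotvv_ge0 (v - s%:C *: w).
rewrite rdotBl !rdotBr !rdotZl !rdotZr (rdotC w) !rdotvv.
rewrite [X in 0 <= X](_ : _ = enorm v ^+ 2 - rdot v w ^+ 2 / enorm w ^+ 2); last first.
  by rewrite /s; field; exact: lt0r_neq0.
rewrite subr_ge0 ler_pdivrMr ?exprn_gt0// -exprMn => h.
rewrite (le_trans (ler_norm _))//.
rewrite -(@ler_pXn2r _ 2)// ?nnegrE ?mulr_ge0 ?enorm_ge0//.
by rewrite -normrX ger0_norm ?sqr_ge0.
Qed.

Lemma ler_enormD n (v w : 'rV[R[i]]_n) : enorm (v + w) <= enorm v + enorm w.
Proof.
rewrite -(@ler_pXn2r _ 2)// ?nnegrE ?addr_ge0 ?enorm_ge0//.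
rewrite -rdotvv rdotDl rdotC rdotDl [rdot w (v + w)]rdotC rdotDl (rdotC w v).
rewrite !rdotvv sqrrD.
have := rdot_le v w; lra.
Qed.

Lemma ler_enorm_sub n (v w : 'rV[R[i]]_n) : enorm v - enorm w <= enorm (v - w).
Proof. by rewrite lerBlDr -{1}(subrK w v) ler_enormD. Qed.

Lemma ler_enorm_dist n (u v w : 'rV[R[i]]_n) :
  enorm (u - w) <= enorm (u - v) + enorm (v - w).
Proof. by rewrite -{1}(subrK v u) -addrA ler_enormD. Qed.

Lemma ler_enorm_sum n (I : finType) (f : I -> 'rV[R[i]]_n) :
  enorm (\sum_i f i) <= \sum_i enorm (f i).
Proof.
elim/big_ind2 : _ => //[|x a y b ha hb]; first by rewrite enorm0.
by rewrite (le_trans (ler_enormD _ _))// lerD.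
Qed.

Lemma enorm_delta n (j : 'I_n) : enorm (delta_mx 0 j : 'rV[R[i]]_n) = 1.
Proof.
rewrite /enorm (bigD1 j)//= big1 => [|i ij]; rewrite !mxE ?eqxx/=.
  by rewrite expr1n expr0n !addr0 sqrtr1.
by rewrite (negbTE ij) /= expr0n addr0.
Qed.

Lemma enorm_le_sum n (v : 'rV[R[i]]_n) : enorm v <= \sum_j normc (v 0 j).
Proof.
rewrite {1}(row_sum_delta v) (le_trans (ler_enorm_sum _))// ler_sum// => j _.
by rewrite enormZ enorm_delta mulr1.
Qed.

Lemma normrcE a : `|a| = (normc a)%:C.
Proof. by case: a => x y; rewrite normc_def. Qed.

Lemma normc_ge0 a : 0 <= normc a.
Proof. by case: a => x y; exact: sqrtr_ge0. Qed.

Lemma normcB_C a (b : R[i]) : normc (a - b) = normc (b - a).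
Proof. by rewrite -normcN opprB. Qed.

Lemma nbhs_normcP a (A : set R[i]) :
  nbhs a A <-> exists2 e : R, 0 < e & forall y, normc (y - a) < e -> A y.
Proof.
split=> [/nbhs_ballP[e /= e0 h]|[e e0 h]].
  have [x] : exists x : R, e = x%:C.
    by move: e0; rewrite ltcE => /andP[/eqP ? _]; exists (complex.Re e);
       apply/eqP; rewrite eq_complex /= eqxx; apply/eqP.
  move=> ex; move: e0 h; rewrite ex ltcR => x0 h; exists x => // y yx.
  by apply: h; rewrite -ball_normE /ball_/= normrcE ltcR normcB_C.
apply/nbhs_ballP; exists e%:C => /=; first by rewrite ltcR.
move=> y; rewrite -ball_normE /ball_/= normrcE ltcR normcB_C; exact: h.
Qed.

(** The balls of ['rV[R[i]]_n] have radii in [R[i]] and come from the maximum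
    norm; real radii and the Euclidean norm define the same neighbourhoods. *)
Lemma nbhs_enormP n (x : 'rV[R[i]]_n) (A : set 'rV[R[i]]_n) :
  nbhs x A <-> exists2 e : R, 0 < e & forall y, enorm (y - x) < e -> A y.
Proof.
split=> [/nbhs_ballP[e /= e0 h]|[e e0 h]].
  have [t] : exists t : R, e = t%:C.
    by move: e0; rewrite ltcE => /andP[/eqP ? _]; exists (complex.Re e);
       apply/eqP; rewrite eq_complex /= eqxx; apply/eqP.
  move=> ex; move: e0 h; rewrite ex ltcR => x0 h; exists t => // y yx.
  apply: h; split=> [|i j]; first by rewrite ltcR.
  rewrite -ball_normE /ball_/= normrcE ltcR normcB_C (ord1 i).
  have := normc_le_enorm (y - x) j; rewrite !mxE => /le_lt_trans; exact.
apply/nbhs_ballP; exists (e / (n.+1)%:R)%:C => /=.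
  by rewrite ltcR divr_gt0.
move=> y [_ xy]; apply: h; apply: le_lt_trans (enorm_le_sum _) _.
apply: (@le_lt_trans _ _ (\sum_(j < n) (e / n.+1%:R))).
  apply: ler_sum => j _; rewrite !mxE ltW//.
  have := xy 0 j.
  by rewrite -ball_normE /ball_/= normrcE ltcR normcB_C.
rewrite sumr_const card_ord -[_ *+ n]mulr_natl mulrCA gtr_pMr//.
by rewrite ltr_pdivrMr// mul1r ltr_nat.
Qed.

Lemma cvg_enormP n (T : Type) (F : set_system T) {FF : Filter F}
    (f : T -> 'rV[R[i]]_n) (l : 'rV[R[i]]_n) :
  f @ F --> l <-> forall e : R, 0 < e -> \forall t \near F, enorm (f t - l) < e.
Proof.
split=> [h e e0|h].
  by apply: (h [set y | enorm (y - l) < e]); apply/nbhs_enormP; exists e.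
move=> A /nbhs_enormP[e e0 eA]; rewrite /nbhs/=.
by have := h _ e0; apply: filterS => t; exact: eA.
Qed.

Lemma cvg_enorm n (T : Type) (F : set_system T) {FF : Filter F}
    (f : T -> 'rV[R[i]]_n) (l : 'rV[R[i]]_n) :
  f @ F --> l -> enorm (f t) @[t --> F] --> enorm l.
Proof.
move=> /cvg_enormP h; apply/cvgrPdist_lt => e /h; apply: filterS => t.
apply: le_lt_trans; rewrite ler_norml; apply/andP; split.
  by rewrite lerNl opprB; exact: ler_enorm_sub.
by rewrite enormBC; exact: ler_enorm_sub.
Qed.

Lemma normc_le_ReIm a : normc a <= `|complex.Re a| + `|complex.Im a|.
Proof.
rewrite {1}(complexE a) (le_trans (le_normcD _ _))// normcR normcM normcR.
by rewrite /= expr0n add0r expr1n sqrtr1 mul1r.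
Qed.

End EuclideanNorm.

(** * Differentials and curves *)

Section Differential.
Local Open Scope complex_scope.
Context {R : realType}.

Lemma linear_enorm_bound n m (L : {linear 'rV[R[i]]_n -> 'rV[R[i]]_m}) :
  exists2 C : R, 0 < C & forall u, enorm (L u) <= C * enorm u.
Proof.
exists (\sum_j enorm (L (delta_mx 0 j)) + 1).
  by rewrite ltr_wpDl// sumr_ge0// => j _; exact: enorm_ge0.
move=> u; rewrite {1}(row_sum_delta u) linear_sum mulrDl mul1r.
apply: (le_trans (ler_enorm_sum _)); rewrite mulr_suml ler_wpDr ?enorm_ge0//.
apply: ler_sum => j _; rewrite linearZ enormZ mulrC ler_wpM2l ?enorm_ge0//.
exact: normc_le_enorm.
Qed.

(** Pointwise convergence of linear maps is uniform on bounded sets, because it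
    only has to be checked on the canonical basis. *)
Lemma linear_family_cvg n m (T : Type) (F : set_system T) {FF : Filter F}
    (L : T -> {linear 'rV[R[i]]_n -> 'rV[R[i]]_m})
    (L0 : {linear 'rV[R[i]]_n -> 'rV[R[i]]_m}) :
  (forall u, L t u @[t --> F] --> L0 u) ->
  forall e : R, 0 < e ->
    \forall t \near F, forall u, enorm (L t u - L0 u) <= e * enorm u.
Proof.
move=> h e e0; pose e' := e / n.+1%:R.
have e'0 : 0 < e' by rewrite divr_gt0.
have : \forall t \near F, forall j, enorm (L t (delta_mx 0 j) - L0 (delta_mx 0 j)) < e'.
  by apply: filter_forall => j; move/cvg_enormP : (h (delta_mx 0 j)); exact.
apply: filterS => t ht u.
have E (M : {linear 'rV[R[i]]_n -> 'rV[R[i]]_m}) :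
    M u = \sum_j u 0 j *: M (delta_mx 0 j).
  by rewrite {1}(row_sum_delta u) linear_sum; under eq_bigr do rewrite linearZ.
rewrite (E (L t)) (E L0) -sumrB.
apply: (le_trans (ler_enorm_sum _)).
apply: (@le_trans _ _ (\sum_(j < n) e' * enorm u)).
  apply: ler_sum => j _; rewrite -scalerBr enormZ mulrC.
  by apply: ler_pM; rewrite ?enorm_ge0 ?normc_ge0 ?normc_le_enorm// ltW.
rewrite sumr_const card_ord -[_ *+ n]mulr_natl mulrA ler_wpM2r ?enorm_ge0//.
by rewrite mulrCA ger_pMr// ler_pdivrMr// mul1r ler_nat.
Qed.

Lemma linear_family_cvg2 n m (T : Type) (F : set_system T) {FF : Filter F}
    (L : T -> {linear 'rV[R[i]]_n -> 'rV[R[i]]_m})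
    (L0 : {linear 'rV[R[i]]_n -> 'rV[R[i]]_m}) (v : T -> 'rV[R[i]]_n) v0 :
  (forall u, L t u @[t --> F] --> L0 u) -> v t @[t --> F] --> v0 ->
  L t (v t) @[t --> F] --> L0 v0.
Proof.
move=> hL /cvg_enormP hv; apply/cvg_enormP => e e0.
have [C C0 hC] := linear_enorm_bound L0.
have e1 : 0 < e / (2 * (enorm v0 + 1)).
  by rewrite divr_gt0// mulr_gt0// ltr_wpDl// enorm_ge0.
have e2 : 0 < e / (2 * C) by rewrite divr_gt0// mulr_gt0.
near=> t.
have h1 : enorm (v t - v0) < 1 by near: t; exact: hv.
have h2 : enorm (v t - v0) < e / (2 * C) by near: t; exact: hv.
have h3 : forall u, enorm (L t u - L0 u) <= e / (2 * (enorm v0 + 1)) * enorm u.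
  by near: t; exact: linear_family_cvg.
rewrite (le_lt_trans (ler_enorm_dist _ (L0 (v t)) _))//.
rewrite [ltRHS](_ : e = e / 2 + e / 2); last by field.
apply: ler_ltD.
  apply: (le_trans (h3 _)).
  have v1 : 0 < enorm v0 + 1 by rewrite ltr_wpDl ?enorm_ge0.
  rewrite [leLHS](_ : _ = e / 2 * (enorm (v t) / (enorm v0 + 1))); last first.
    by field; exact: lt0r_neq0.
  rewrite ger_pMr ?divr_gt0// ler_pdivrMr// mul1r.
  have := ler_enorm_sub (v t) v0; lra.
rewrite -linearB (le_lt_trans (hC _))//.
rewrite -ltr_pdivlMl// (lt_le_trans h2)//.
by rewrite invfM mulrA mulrC.
Unshelve. all: by end_near. Qed.

Lemma norm_le_enorm n (v : 'rV[R[i]]_n) : `|v| <= (enorm v)%:C.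
Proof.
have [->|v0] := eqVneq v 0; first by rewrite normr0 enorm0.
have : mx_norm v != 0 by apply: contra v0 => /eqP/mx_norm_eq0 ->.
move=> /mx_norm_neq0[[i j] /= vij]; rewrite {1}/Num.Def.normr/= vij.
by rewrite normrcE lecR (ord1 i) normc_le_enorm.
Qed.

Lemma norm_row_coord n (v : 'rV[R[i]]_n) j : `|v 0 j| <= `|v|.
Proof.
rewrite {2}/Num.Def.normr/= mx_normE -[leLHS]nngE num_le.
exact: (le_bigmax _ (fun i : 'I_1 * 'I_n => `|v i.1 i.2|%:nng) (0, j)).
Qed.

Lemma enorm_le_norm n (v : 'rV[R[i]]_n) : (enorm v)%:C <= n%:R * `|v|.
Proof.
apply: (@le_trans _ _ (\sum_(j < n) normc (v 0 j))%:C).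
  by rewrite lecR enorm_le_sum.
rewrite rmorph_sum/= mulr_natl -[X in _ *+ X](card_ord n) -sumr_const ler_sum//.
by move=> j _; rewrite -normrcE norm_row_coord.
Qed.

(** The first-order expansion for the Euclidean norm. The expansion given by
    differentiability is for the maximum norm, which is off by a factor at most
    the dimension. *)
Lemma diff_approx n m (f : 'rV[R[i]]_n -> 'rV[R[i]]_m) x : differentiable f x ->
  forall e : R, 0 < e ->
    \forall y \near x, enorm (f y - f x - 'd f x (y - x)) <= e * enorm (y - x).
Proof.
move=> df e e0; have e'0 : 0 < (e / m.+1%:R)%:C by rewrite ltcR divr_gt0.
have /eqaddoP/(_ _ e'0) := diff_locally df.
move=> /nbhs_enormP[d d0 h].
apply/nbhs_enormP; exists d => // y yx.
have := h (y - x); rewrite subr0 => /(_ yx).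
rewrite /= !fctE /= subrK opprD addrA => h'.
rewrite -lecR (le_trans (enorm_le_norm _))//.
apply: (@le_trans _ _ (m%:R * ((e / m.+1%:R)%:C * `|y - x|))).
  by rewrite ler_wpM2l.
rewrite [leRHS]rmorphM mulrA; apply: ler_pM => //.
- by rewrite mulr_ge0// ler0c divr_ge0// ltW.
- rewrite -[m%:R](rmorph_nat (real_complex R)) -rmorphM /= lecR.
  by rewrite mulrCA ger_pMr// ler_pdivrMr// mul1r ler_nat.
- exact: norm_le_enorm.
Qed.

End Differential.

Section Curves.
Local Open Scope complex_scope.
Context {R : realType}.

Lemma holomorphic_at_near n (V : normedModType R[i]) (f : 'rV[R[i]]_n -> V) x :
  holomorphic_at f x -> \forall y \near x, holomorphic_at f y.
Proof. by move=> /nbhs_interior. Qed.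

Lemma holomorphic_at_differentiable n (V : normedModType R[i])
    (f : 'rV[R[i]]_n -> V) x : holomorphic_at f x -> differentiable f x.
Proof. by move=> /nbhs_singleton[]. Qed.

Lemma holomorphic_at_continuous n (V : normedModType R[i])
    (f : 'rV[R[i]]_n -> V) x : holomorphic_at f x -> {for x, continuous f}.
Proof.
by move=> /holomorphic_at_differentiable; exact: differentiable_continuous.
Qed.

Lemma holomorphic_at_diff_continuous n (V : normedModType R[i])
    (f : 'rV[R[i]]_n -> V) x u :
  holomorphic_at f x -> 'd f y u @[y --> x] --> 'd f x u.
Proof. by move=> /nbhs_singleton[_]; exact. Qed.

(** Joint continuity of the differential in the point and the vector: continuity
    in the point is assumed for each fixed vector only, and linearity does the
    rest. *)
Lemma diff_cvg n m (f : 'rV[R[i]]_n -> 'rV[R[i]]_m) (T : Type)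
    (F : set_system T) {FF : Filter F} (p v : T -> 'rV[R[i]]_n) p0 v0 :
  holomorphic_at f p0 -> p t @[t --> F] --> p0 -> v t @[t --> F] --> v0 ->
  'd f (p t) (v t) @[t --> F] --> 'd f p0 v0.
Proof.
move=> hf hp hv; apply: (@linear_family_cvg2 _ _ _ _ _ _ (fun t => 'd f (p t)))=> // u.
by apply: (cvg_comp p (fun y => 'd f y u) hp); exact: holomorphic_at_diff_continuous.
Qed.

Lemma near_dist (t d : R) : 0 < d -> \forall s \near t, `|s - t| < d.
Proof. by move=> d0; apply/nbhs_ballP; exists d => // s; rewrite /ball/= distrC. Qed.

(** The derivative of a curve with a real parameter in a space normed over
    [R[i]], given by a first-order expansion so that it composes with complex
    differentials. *)
Definition has_velocity n (c : R -> 'rV[R[i]]_n) (t : R) (v : 'rV[R[i]]_n) :=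
  forall e : R, 0 < e ->
    \forall s \near t, enorm (c s - c t - (s - t)%:C *: v) <= e * `|s - t|.

Lemma has_velocity_continuous n (c : R -> 'rV[R[i]]_n) t v :
  has_velocity c t v -> {for t, continuous c}.
Proof.
move=> hc; apply/cvg_enormP => e e0.
have d0 : 0 < e / (1 + enorm v) by rewrite divr_gt0// ltr_pwDl// enorm_ge0.
near=> s.
have h1 : enorm (c s - c t - (s - t)%:C *: v) <= 1 * `|s - t| by near: s; exact: hc.
have h2 : `|s - t| < e / (1 + enorm v).
  by near: s; exact: near_dist.
move: h2; rewrite ltr_pdivlMr ?ltr_pwDl ?enorm_ge0// => h2.
have := ler_enorm_sub (c s - c t) ((s - t)%:C *: v).
rewrite enormZR; move: h1 h2; rewrite mul1r mulrDr mulr1; lra.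
Unshelve. all: by end_near. Qed.

Lemma has_velocity_comp n m (f : 'rV[R[i]]_n -> 'rV[R[i]]_m)
    (c : R -> 'rV[R[i]]_n) t v :
  differentiable f (c t) -> has_velocity c t v ->
  has_velocity (f \o c) t ('d f (c t) v).
Proof.
move=> df hc e e0; have [C C0 hC] := linear_enorm_bound ('d f (c t)).
have cc := has_velocity_continuous hc.
have e1 : 0 < e / (2 * (1 + enorm v)).
  by rewrite divr_gt0// mulr_gt0// ltr_pwDl// enorm_ge0.
have e2 : 0 < e / (2 * C) by rewrite divr_gt0// mulr_gt0.
near=> s.
have h0 : enorm (c s - c t - (s - t)%:C *: v) <= 1 * `|s - t| by near: s; exact: hc.
have h1 : enorm (c s - c t - (s - t)%:C *: v) <= e / (2 * C) * `|s - t|.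
  by near: s; exact: hc.
have h2 : enorm (f (c s) - f (c t) - 'd f (c t) (c s - c t)) <=
    e / (2 * (1 + enorm v)) * enorm (c s - c t).
  by near: s; exact: (cc _ (diff_approx df e1)).
have h3 : enorm (c s - c t) <= (1 + enorm v) * `|s - t|.
  have := ler_enorm_sub (c s - c t) ((s - t)%:C *: v).
  rewrite enormZR; move: h0; lra.
rewrite /= (le_trans (ler_enorm_dist _ ('d f (c t) (c s - c t)) _))//.
rewrite -[X in _ <= X * _](_ : e / 2 + e / 2 = e); last by field.
rewrite mulrDl lerD//.
  apply: (le_trans h2).
  have v1 : 0 < 1 + enorm v by rewrite ltr_pwDl ?enorm_ge0.
  rewrite [leRHS](_ : _ = e / (2 * (1 + enorm v)) * ((1 + enorm v) * `|s - t|)).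
    by rewrite ler_wpM2l// ltW.
  by field; exact: lt0r_neq0.
rewrite -linearZ -linearB (le_trans (hC _))//.
apply: (@le_trans _ _ (C * (e / (2 * C) * `|s - t|))); first by rewrite ler_wpM2l// ltW.
by rewrite le_eqVlt; apply/orP; left; apply/eqP; field; exact: lt0r_neq0.
Unshelve. all: by end_near. Qed.

Lemma is_derive_approx (f : R -> R) (t df : R) :
  (forall e : R, 0 < e -> \forall s \near t, `|f s - f t - (s - t) * df| <= e * `|s - t|)
  -> is_derive t 1 f df.
Proof.
move=> h; have : h^-1 *: ((f \o shift t) (h *: 1) - f t) @[h --> 0^'] --> df.
  apply/cvgrPdist_le => e e0; have := h _ e0.
  rewrite (near_shift 0) => h0; near=> u.
  have u0 : u != 0 by near: u; exact: nbhs_dnbhs_neq.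
  have : `|f (u + t) - f t - u * df| <= e * `|u|.
    have : ((fun s => `|f s - f t - (s - t) * df| <= e * `|s - t|) \o shift (t - 0)) u.
      by near: u; exact: nbhs_dnbhs.
    by rewrite /= subr0 addrK.
  rewrite /= -ler_pdivrMr ?normr_gt0// -normfV -normrM => h1.
  rewrite distrC [X in `|X|](_ : _ = (f (u + t) - f t - u * df) / u)//.
  by rewrite /GRing.scale /= mulr1 mulrBl [u * df]mulrC mulfK// mulrC.
move=> hc; apply: DeriveDef; first by apply/cvg_ex; exists df.
by apply: cvg_lim.
Unshelve. all: by end_near. Qed.

Lemma is_derive_approxP (f : R -> R) (t df : R) : is_derive t 1 f df ->
  forall e : R, 0 < e -> \forall s \near t, `|f s - f t - (s - t) * df| <= e * `|s - t|.
Proof.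
move=> [fd <-] e e0.
have /eqaddoP/(_ _ e0) := derivable_nbhs fd.
rewrite (near_shift 0 t) => /=; apply: filterS => s.
by rewrite /= !fctE /= subr0 addrK /GRing.scale /= mulr1 opprD addrA.
Qed.

Lemma has_velocity_rdot n (c : R -> 'rV[R[i]]_n) t v w : has_velocity c t v ->
  is_derive t 1 (fun s => rdot (c s) w) (rdot v w).
Proof.
move=> hc; apply: is_derive_approx => e e0.
have w1 : 0 < 1 + enorm w by rewrite ltr_pwDl ?enorm_ge0.
have e1 : 0 < e / (1 + enorm w) by rewrite divr_gt0.
have := hc _ e1; apply: filterS => s hs.
rewrite -rdotBl -rdotZl -rdotBl.
have : `|rdot (c s - c t - (s - t)%:C *: v) w| <=
    enorm (c s - c t - (s - t)%:C *: v) * enorm w.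
  rewrite ler_norml rdot_le andbT lerNl -rdotNl (le_trans (rdot_le _ _))//.
  by rewrite enormN.
move=> /le_trans; apply.
apply: (@le_trans _ _ (e / (1 + enorm w) * `|s - t| * (1 + enorm w))).
  by apply: ler_pM; rewrite ?enorm_ge0 ?lerDr//.
by rewrite le_eqVlt; apply/orP; left; apply/eqP; field; exact: lt0r_neq0.
Qed.

Lemma rdot_deltaRe n (v : 'rV[R[i]]_n) j :
  rdot v (delta_mx 0 j) = complex.Re (v 0 j).
Proof.
rewrite /rdot (bigD1 j)//= big1 => [|k kj]; rewrite !mxE ?eqxx/=.
  by rewrite mulr1 mulr0 !addr0.
by rewrite (negbTE kj) /= !mulr0 addr0.
Qed.

Lemma rdot_deltaIm n (v : 'rV[R[i]]_n) j :
  rdot v ('i *: delta_mx 0 j) = complex.Im (v 0 j).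
Proof.
rewrite /rdot (bigD1 j)//= big1 => [|k kj]; rewrite !mxE ?eqxx/=; first by ring.
by rewrite (negbTE kj) /=; ring.
Qed.

(** The real and imaginary parts of the coordinate [j] are the inner products with
    [delta_mx 0 j] and ['i *: delta_mx 0 j]. *)
Lemma has_velocityP n (c : R -> 'rV[R[i]]_n) t v :
  has_velocity c t v <->
  forall j, is_derive t 1 (fun s => complex.Re (c s 0 j)) (complex.Re (v 0 j)) /\
            is_derive t 1 (fun s => complex.Im (c s 0 j)) (complex.Im (v 0 j)).
Proof.
split=> [hc j|h e e0].
  have := has_velocity_rdot (delta_mx 0 j) hc.
  have := has_velocity_rdot ('i *: delta_mx 0 j) hc.
  rewrite rdot_deltaRe rdot_deltaIm.
  under eq_fun do rewrite rdot_deltaIm.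
  by under [X in _ -> is_derive _ _ X _ -> _]eq_fun do rewrite rdot_deltaRe.
have e1 : 0 < e / (2 * n.+1%:R) by rewrite divr_gt0.
have : \forall s \near t, forall j,
  `|complex.Re (c s 0 j) - complex.Re (c t 0 j) - (s - t) * complex.Re (v 0 j)| <=
    e / (2 * n.+1%:R) * `|s - t| /\
  `|complex.Im (c s 0 j) - complex.Im (c t 0 j) - (s - t) * complex.Im (v 0 j)| <=
    e / (2 * n.+1%:R) * `|s - t|.
  apply: (@filter_forall R 'I_n _ (nbhs t)) => j; have [hr hi] := h j.
  by move: (is_derive_approxP hr e1) (is_derive_approxP hi e1); exact: filterS2.
apply: filterS => s hs; apply: (le_trans (enorm_le_sum _)).
apply: (@le_trans _ _ (\sum_(j < n) e / n.+1%:R * `|s - t|)).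
  apply: ler_sum => j _; apply: (le_trans (normc_le_ReIm _)).
  have [hr hi] := hs j; rewrite !mxE.
  move: hr hi; case: (c s 0 j) => a b; case: (c t 0 j) => a' b'.
  case: (v 0 j) => a'' b'' /=; rewrite !mul0r addr0 subr0 => hr hi.
  apply: (le_trans (lerD hr hi)).
  by rewrite le_eqVlt; apply/orP; left; apply/eqP; field.
rewrite sumr_const card_ord -[_ *+ n]mulr_natl mulrA ler_wpM2r//.
by rewrite mulrCA ger_pMr// ler_pdivrMr// mul1r ler_nat.
Qed.

Lemma has_velocity_velocity n (c : R -> 'rV[R[i]]_n) t v :
  has_velocity c t v -> velocity c t = v.
Proof.
move=> /has_velocityP h; apply/rowP => j; rewrite mxE.
have [hr hi] := h j; rewrite !derive1E !derive_val.
by case: (v 0 j).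
Qed.

Lemma C1_has_velocity n (c : R -> 'rV[R[i]]_n) t :
  C1_curve c -> has_velocity c t (velocity c t).
Proof.
move=> [hc _]; apply/has_velocityP => j; have [hr hi] := hc t j.
by rewrite !mxE /= !derive1E; split; exact: derivableP.
Qed.

Lemma C1_curveI n (c v : R -> 'rV[R[i]]_n) :
  (forall t, has_velocity c t (v t)) -> continuous v -> C1_curve c.
Proof.
move=> hc cv; split=> [t j|].
  by have /has_velocityP/(_ j)[[? _] [? _]] := hc t.
by rewrite (_ : velocity c = v)//; apply/funext => t; exact: has_velocity_velocity.
Qed.

Lemma near_eq_velocity n (c d : R -> 'rV[R[i]]_n) t :
  (\forall s \near t, c s = d s) -> velocity c t = velocity d t.
Proof.
move=> h; apply/rowP => j; rewrite !mxE.
have hr : \forall s \near t, complex.Re (c s 0 j) = complex.Re (d s 0 j).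
  by apply: filterS h => s ->.
have hi : \forall s \near t, complex.Im (c s 0 j) = complex.Im (d s 0 j).
  by apply: filterS h => s ->.
by rewrite !derive1E (near_eq_derive _ hr) ?oner_neq0// (near_eq_derive _ hi) ?oner_neq0.
Qed.

End Curves.

(** * Piecewise C^1 curves and their lengths *)

Section PiecewiseC1.
Local Open Scope complex_scope.
Context {R : realType}.
Notation mu := (@lebesgue_measure R).

(** An inductive form of [piecewise_C1] on nondegenerate intervals, in which
    restricting and concatenating curves need no handling of subdivisions. *)
Inductive pwC1 n (c : R -> 'rV[R[i]]_n) : R -> R -> Prop :=
| pwC1_one a b e : a < b -> C1_curve e ->
    (forall t, a <= t <= b -> c t = e t) -> pwC1 c a b
| pwC1_cat a m b : pwC1 c a m -> pwC1 c m b -> pwC1 c a b.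

Lemma pwC1_lt n (c : R -> 'rV[R[i]]_n) a b : pwC1 c a b -> a < b.
Proof. by elim=> // {}a m {}b _ am _ mb; exact: lt_trans mb. Qed.

Lemma pwC1_sub n (c : R -> 'rV[R[i]]_n) a b : pwC1 c a b ->
  forall x y, a <= x -> x < y -> y <= b -> pwC1 c x y.
Proof.
elim=> [{}a {}b e ab he ce|{}a m {}b _ h1 _ h2] x y ax xy yb.
  apply: (pwC1_one xy he) => t /andP[xt ty].
  by apply: ce; rewrite (le_trans ax xt) (le_trans ty yb).
have [ym|my] := leP y m; first exact: h1.
have [mx|xm] := leP m x; first exact: h2.
by apply: (@pwC1_cat _ _ x m y); [apply: h1|apply: h2; rewrite // ltW].
Qed.

Lemma pwC1_ext n (c d : R -> 'rV[R[i]]_n) a b :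
  (forall t, a <= t <= b -> c t = d t) -> pwC1 c a b -> pwC1 d a b.
Proof.
move=> cd hc; elim: hc cd => [{}a {}b e ab he ce|{}a m {}b h1 ih1 h2 ih2] cd.
  by apply: (pwC1_one ab he) => t atb; rewrite -cd// ce.
have /ltW am := pwC1_lt h1; have /ltW mb := pwC1_lt h2.
apply: pwC1_cat (ih1 _) (ih2 _) => t /andP[h3 h4]; apply: cd.
  by rewrite h3 (le_trans h4).
by rewrite h4 (le_trans am h3).
Qed.

Lemma piecewise_C1_pwC1 n (c : R -> 'rV[R[i]]_n) a b :
  a < b -> piecewise_C1 a b c -> pwC1 c a b.
Proof.
move=> + [s]; elim: s a => [a ab [/itv_partition_nil ab' _]|x s ih a ab [hs hc]].
  by rewrite ab' ltxx in ab.
have ax : a < x by case: hs => /= /andP[].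
have one : pwC1 c a x.
  have [e [he ce]] := hc 0%N (ltn0Sn _).
  by apply: (pwC1_one ax he) => t atx; apply: ce; rewrite /= in_itv.
have hs' := itv_partition_cons hs.
have [xb|] := ltP x b; last first.
  move=> bx; suff -> : b = x by [].
  by apply/le_anti; rewrite bx (itv_partition_le hs').
apply: pwC1_cat one (ih _ xb _); split => // i si.
by have := hc i.+1 si.
Qed.

Lemma pwC1_piecewise_C1 n (c : R -> 'rV[R[i]]_n) a b :
  pwC1 c a b -> piecewise_C1 a b c.
Proof.
elim=> [{}a {}b e ab he ce|{}a m {}b h1 [s1 [p1 c1]] h2 [s2 [p2 c2]]].
  exists [:: b]; split; first exact: itv_partition1.
  case=> // _; exists e; split => // t; rewrite /= in_itv; exact: ce.
exists (s1 ++ s2); split; first exact: itv_partition_cat p1 p2.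
move=> i; rewrite size_cat => i12.
have [is1|s1i] := ltnP i (size s1).
  have [e [he ce]] := c1 i is1; exists e; split => // t.
  rewrite -cat_cons !nth_cat /= ltnS (ltnW is1) ltnS is1.
  rewrite (set_nth_default m b)/= ?ltnS ?(ltnW is1)//.
  by rewrite (set_nth_default m b)//; exact: ce.
have [e [he ce]] := c2 (i - size s1)%N ltac:(by rewrite ltn_subLR).
exists e; split => // t; move: ce => /(_ t); rewrite /=.
have -> : nth b (s1 ++ s2) i = nth b s2 (i - size s1) by rewrite nth_cat ltnNge s1i.
suff -> : nth b (a :: s1 ++ s2) i = nth b (m :: s2) (i - size s1) by [].
rewrite -cat_cons nth_cat /= ltnS.
move: s1i; rewrite leq_eqVlt => /predU1P[<-|s1i].
  rewrite leqnn subnn /=; case: p1 => _ /eqP <-.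
  by rewrite (last_nth b).
rewrite leqNgt s1i /= subnS -(prednK (n := i - size s1)) ?subn_gt0//=.
Qed.

Lemma within_continuous_enormP (T : topologicalType) n (A : set T)
    (c : T -> 'rV[R[i]]_n) :
  {within A, continuous c} <->
  forall x, A x -> forall e : R, 0 < e ->
    \forall y \near x, A y -> enorm (c y - c x) < e.
Proof.
apply: (iff_trans (subspace_continuousP _ _)); split=> h x Ax.
  by move=> e e0; move/cvg_enormP : (h x Ax) => /(_ _ e0); rewrite near_withinE.
by apply/cvg_enormP => e e0; rewrite near_withinE; exact: h.
Qed.

Lemma pwC1_continuous n (c : R -> 'rV[R[i]]_n) a b :
  pwC1 c a b -> {within `[a, b], continuous c}.
Proof.
elim=> [{}a {}b e ab he ce|{}a m {}b h1 ih1 h2 ih2].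
  apply/within_continuous_enormP => x /=; rewrite in_itv/= => xab r r0.
  have /cvg_enormP/(_ _ r0) : {for x, continuous e}.
    exact: has_velocity_continuous (C1_has_velocity x he).
  apply: filterS => y; rewrite /= in_itv/= => h yab.
  by rewrite (ce _ xab) (ce _ yab).
have -> : `[a, b]%classic = `[a, m] `|` `[m, b].
  apply/seteqP; split => x /=; rewrite !in_itv/=.
    move=> /andP[ax xb]; have [xm|/ltW mx] := leP x m; [left|right].
      by rewrite ax.
    by rewrite mx.
  have /ltW am := pwC1_lt h1; have /ltW mb := pwC1_lt h2.
  by case=> /andP[h3 h4]; rewrite ?h3 ?h4 ?(le_trans h4 mb) ?(le_trans am h3).
by apply: withinU_continuous => //; exact: interval_closed.
Qed.

End PiecewiseC1.

Section Speed.
Local Open Scope complex_scope.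
Context {R : realType}.
Notation mu := (@lebesgue_measure R).

Lemma measurable_fun_oo_cat (f : R -> \bar R) (a m b : R) : a < m -> m < b ->
  measurable_fun `]a, m[ f -> measurable_fun `]m, b[ f -> measurable_fun `]a, b[ f.
Proof.
move=> am mb f1 f2.
have -> : `]a, b[%classic = `]a, m[ `|` ([set m] `|` `]m, b[).
  apply/seteqP; split => x /=; rewrite !in_itv/=.
    move=> /andP[ax xb]; case: (ltgtP x m) => xm; first by left; rewrite ax.
      by right; right.
    by right; left.
  case=> [/andP[-> /lt_trans->]//|[->|/andP[mx ->]]]; first by rewrite am.
  by rewrite (lt_trans am mx).
apply/measurable_funU => //; first exact: measurableU.
split => //; apply/measurable_funU => //; split => //.
exact: measurable_fun_set1.
Qed.

Lemma integral_oo_cat (f : R -> \bar R) (a m b : R) : a < m -> m < b ->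
  measurable_fun `]a, m[ f -> measurable_fun `]m, b[ f ->
  (forall x, 0 <= f x)%E ->
  (\int[mu]_(x in `]a, b[) f x =
   \int[mu]_(x in `]a, m[) f x + \int[mu]_(x in `]m, b[) f x)%E.
Proof.
move=> am mb f1 f2 f0.
have E : `]a, b[%classic = `]a, m[ `|` `[m, b[.
  apply/seteqP; split => x /=; rewrite !in_itv/=.
    move=> /andP[ax xb]; have [xm|mx] := ltP x m; first by left; rewrite ax.
    by right.
  case=> [/andP[-> /lt_trans->]//|/andP[mx ->]].
  by rewrite (lt_le_trans am mx).
rewrite {1}E ge0_integral_setU//; last 2 first.
- by rewrite -E; exact: measurable_fun_oo_cat f1 f2.
- apply/disj_setPS => x []/=; rewrite !in_itv/= => /andP[_ xm] /andP[mx _].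
  by move: (le_lt_trans mx xm); rewrite ltxx.
by congr (_ + _)%E; rewrite integral_itv_bndoo.
Qed.

Lemma speed_continuous n m (f : 'rV[R[i]]_n -> 'rV[R[i]]_m) e t :
  C1_curve e -> holomorphic_at f (e t) ->
  {for t, continuous (fun t => pullback_norm f (e t) (velocity e t))}.
Proof.
move=> he hf; apply: cvg_enorm; apply: diff_cvg => //.
  exact: has_velocity_continuous (C1_has_velocity t he).
by case: he => _; exact.
Qed.

(** At an end of the interval [c] need not agree with [e] on a neighbourhood, which
    is why speeds are integrated over open intervals. *)
Lemma pwC1_one_velocity n (c e : R -> 'rV[R[i]]_n) (a b t : R) :
  (forall t, a <= t <= b -> c t = e t) -> a < t < b ->
  \forall s \near t, c s = e s.
Proof.
move=> ce atb; have tab : t \in `]a, b[%R by rewrite in_itv.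
have := near_in_itvoo tab.
by apply: filterS => s; rewrite in_itv/= => /andP[/ltW ? /ltW ?]; apply/ce/andP.
Qed.

Lemma speed_measurable n m (f : 'rV[R[i]]_n -> 'rV[R[i]]_m) c (a b : R) :
  pwC1 c a b -> (forall t, a <= t <= b -> holomorphic_at f (c t)) ->
  measurable_fun `]a, b[ (fun t => (pullback_norm f (c t) (velocity c t))%:E).
Proof.
elim=> [{}a {}b e ab he ce|{}a p {}b h1 ih1 h2 ih2] hf; last first.
  have ap := pwC1_lt h1; have pb := pwC1_lt h2.
  apply: (measurable_fun_oo_cat ap pb).
    apply: ih1 => t /andP[at' tp]; apply: hf.
    by rewrite at' (le_trans tp)// ltW.
  apply: ih2 => t /andP[pt tb]; apply: hf.
  by rewrite tb andbT (le_trans _ pt)// ltW.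
apply/measurable_EFinP.
apply: (@eq_measurable_fun _ _ _ _ _
  (fun t => pullback_norm f (e t) (velocity e t))) => [t|].
  rewrite inE/= in_itv/= => atb; have h := pwC1_one_velocity ce atb.
  by rewrite (near_eq_velocity h) (nbhs_singleton h).
apply: open_continuous_measurable_fun; first exact: interval_open.
move=> t; rewrite inE/= in_itv/= => /andP[/ltW at' /ltW tb].
have tab : a <= t <= b by rewrite at'.
by apply: speed_continuous => //; rewrite -ce//; exact: hf.
Qed.

(** With [v] the total displacement of [f \o e], the inner product of [f \o e] with
    [v] increases by the square of [enorm v], while its derivative is at most the
    speed times [enorm v]. *)
Lemma C1_length_ge n m (f : 'rV[R[i]]_n -> 'rV[R[i]]_m) e (a b : R) : a < b ->
  C1_curve e -> (forall t, a <= t <= b -> holomorphic_at f (e t)) ->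
  ((enorm (f (e b) - f (e a)))%:E <=
   \int[mu]_(t in `]a, b[) (pullback_norm f (e t) (velocity e t))%:E)%E.
Proof.
move=> ab he hf; set v := f (e b) - f (e a).
have [->|v0] := eqVneq v 0; first by rewrite enorm0 integral_ge0// => t _; rewrite lee_fin enorm_ge0.
have {}v0 := enorm_gt0 v0.
have hv t : a <= t <= b -> has_velocity (f \o e) t ('d f (e t) (velocity e t)).
  move=> /hf hft; apply: has_velocity_comp (C1_has_velocity t he).
  exact: holomorphic_at_differentiable.
pose psi t := rdot (f (e t)) v.
pose dpsi t := rdot ('d f (e t) (velocity e t)) v.
pose sp t := pullback_norm f (e t) (velocity e t) * enorm v.
have psi' t : a <= t <= b -> is_derive t 1 psi (dpsi t).
  by move=> /hv /(has_velocity_rdot v).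
have csp : {within `[a, b], continuous sp}.
  apply: continuous_in_subspaceT => t; rewrite inE/= in_itv/= => /hf hft.
  by apply: cvgMl; exact: speed_continuous.
have cdpsi : {within `[a, b], continuous dpsi}.
  apply: continuous_in_subspaceT => t; rewrite inE/= in_itv/= => /hf hft.
  have /cvg_enormP h : 'd f (e s) (velocity e s) @[s --> t] --> 'd f (e t) (velocity e t).
    apply: diff_cvg => //; last by case: he => _; exact.
    exact: has_velocity_continuous (C1_has_velocity t he).
  apply/cvgrPdist_lt => r r0; have := h _ (divr_gt0 r0 v0).
  apply: filterS => s; rewrite ltr_pdivlMr// => /(le_lt_trans _); apply.
  rewrite /dpsi -rdotBl enormBC ler_norml rdot_le andbT lerNl -rdotNl.
  by rewrite (le_trans (rdot_le _ _))// enormN.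
have FTC : (\int[mu]_(t in `[a, b]) (dpsi t)%:E = (psi b)%:E - (psi a)%:E)%E.
  apply: continuous_FTC2 => //.
    split=> [t||].
    - rewrite in_itv/= => /andP[/ltW ? /ltW ?].
      by have [] : is_derive t 1 psi (dpsi t) by apply: psi'; apply/andP.
    - apply: cvg_at_right_filter; apply: differentiable_continuous.
      by apply/derivable1_diffP; have [] : is_derive a 1 psi (dpsi a) by apply: psi'; rewrite lexx ltW.
    - apply: cvg_at_left_filter; apply: differentiable_continuous.
      by apply/derivable1_diffP; have [] : is_derive b 1 psi (dpsi b) by apply: psi'; rewrite lexx ltW.
  move=> t; rewrite in_itv/= => /andP[/ltW ? /ltW ?].
  by rewrite derive1E; have [] : is_derive t 1 psi (dpsi t) by apply: psi'; apply/andP.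
have le : (\int[mu]_(t in `[a, b]) (dpsi t)%:E <= \int[mu]_(t in `[a, b]) (sp t)%:E)%E.
  apply: le_integral => //.
  - by apply: continuous_compact_integrable => //; exact: segment_compact.
  - by apply: continuous_compact_integrable => //; exact: segment_compact.
  - by move=> t _; rewrite lee_fin rdot_le.
have msp : measurable_fun `]a, b[ (fun t => (pullback_norm f (e t) (velocity e t))%:E).
  by apply: speed_measurable hf; exact: (pwC1_one ab he).
move: le; rewrite FTC -EFinB /psi -rdotBl -/v rdotvv expr2.
rewrite integral_itv_bndoo; last first.
  rewrite (_ : (fun x => _) = (fun t => (pullback_norm f (e t) (velocity e t))%:E * (enorm v)%:E)%E)//.
  exact: emeasurable_funM.
under eq_integral do rewrite /sp EFinM muleC.
rewrite ge0_integralZl//; last 2 first.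
- by move=> t _; rewrite lee_fin enorm_ge0.
- by rewrite lee_fin enorm_ge0.
by rewrite EFinM lee_pmul2l// lte_fin.
Qed.

(** The comparison of [g] with [f] is only asked of true velocities: at the
    finitely many break points [velocity c] has no meaning. *)
Lemma pwC1_length_ge n m k (f : 'rV[R[i]]_n -> 'rV[R[i]]_m)
    (g : 'rV[R[i]]_n -> 'rV[R[i]]_k) (C : R) c (a b : R) :
  0 <= C -> pwC1 c a b ->
  (forall t, a <= t <= b -> holomorphic_at f (c t)) ->
  (forall t, a <= t <= b -> holomorphic_at g (c t)) ->
  (forall t v, a < t < b -> has_velocity c t v ->
     enorm ('d g (c t) v) <= C * enorm ('d f (c t) v)) ->
  ((enorm (g (c b) - g (c a)))%:E <=
   C%:E * \int[mu]_(t in `]a, b[) (pullback_norm f (c t) (velocity c t))%:E)%E.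
Proof.
move=> C0; elim=> [{}a {}b e ab he ce|{}a p {}b h1 ih1 h2 ih2] hf hg hC; last first.
  have ap := pwC1_lt h1; have pb := pwC1_lt h2.
  have L t : a <= t <= p -> a <= t <= b by move=> /andP[-> /le_trans]; apply; exact: ltW.
  have L' t : p <= t <= b -> a <= t <= b.
    by move=> /andP[+ ->]; rewrite andbT; apply: le_trans; exact: ltW.
  rewrite (integral_oo_cat ap pb); last 3 first.
  - by apply: (speed_measurable h1) => t /L; exact: hf.
  - by apply: (speed_measurable h2) => t /L'; exact: hf.
  - by move=> t; rewrite lee_fin enorm_ge0.
  rewrite ge0_muleDr; last 2 first.
  - by apply: integral_ge0 => t _; rewrite lee_fin enorm_ge0.
  - by apply: integral_ge0 => t _; rewrite lee_fin enorm_ge0.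
  apply: (@le_trans _ _ ((enorm (g (c p) - g (c a)))%:E + (enorm (g (c b) - g (c p)))%:E)%E).
    by rewrite -EFinD lee_fin [leRHS]addrC ler_enorm_dist.
  apply: leeD.
    apply: ih1 => [t /L/hf//|t /L/hg//|t v /andP[at' tp]]; apply: hC.
    by rewrite at' (lt_trans tp pb).
  apply: ih2 => [t /L'/hf//|t /L'/hg//|t v /andP[pt tb]]; apply: hC.
  by rewrite tb andbT (lt_trans ap pt).
have he' t : a <= t <= b -> holomorphic_at g (e t) by move=> tab; rewrite -ce//; exact: hg.
have -> : c a = e a by apply: ce; rewrite lexx ltW.
have -> : c b = e b by apply: ce; rewrite lexx ltW.
apply: (le_trans (C1_length_ge ab he he')).
rewrite -ge0_integralZl//; last 2 first.
- by apply: speed_measurable hf; exact: (pwC1_one ab he).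
- by move=> t _; rewrite lee_fin enorm_ge0.
apply: ge0_le_integral => //.
- by move=> t _; rewrite lee_fin enorm_ge0.
- by apply: speed_measurable he'; exact: (pwC1_one ab he).
- apply: measurable_funeM.
  by apply: speed_measurable hf; exact: (pwC1_one ab he).
- move=> t /=; rewrite in_itv/= => tab.
  have h := pwC1_one_velocity ce tab.
  rewrite -EFinM lee_fin (near_eq_velocity h) -(nbhs_singleton h); apply: hC => //.
  move=> r r0; rewrite (nbhs_singleton h).
  by move: h (C1_has_velocity t he r0); apply: filterS2 => s ->.
Qed.

End Speed.

(** * Subdivisions of an interval *)

Section Subdivision.
Local Open Scope complex_scope.
Context {R : realType}.

(** Let [m] be the supremum of the [x] such that [P a x]. The local hypothesis at
    [m] joins a point just before [m] to a point after it, so that [m = b]. *)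
Lemma cousin (P : R -> R -> Prop) (a b : R) : a < b ->
  (forall s t u, a <= s -> s < t -> t < u -> u <= b -> P s t -> P t u -> P s u) ->
  (forall x, a <= x <= b -> exists2 d, 0 < d &
     forall s t, a <= s -> s <= x -> x <= t -> t <= b -> s < t ->
       x - d < s -> t < x + d -> P s t) ->
  P a b.
Proof.
move=> ab Pcat Ploc.
pose S := [set x | a < x <= b /\ P a x].
have [d0 d00 h0] : exists2 d, 0 < d & forall t, a < t -> t <= b -> t < a + d -> P a t.
  have [|d d0 h] := Ploc a; first by rewrite lexx ltW.
  by exists d => // t at' tb td; apply: h => //; [exact: ltW|rewrite ltrBlDr ltrDl].
have S0 : S !=set0.
  exists (Num.min b (a + d0 / 2)); split.
    by rewrite lt_min ab ltrDl divr_gt0//= ge_min lexx.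
  apply: h0; rewrite ?lt_min ?ab ?ltrDl ?divr_gt0// ?ge_min ?lexx//.
  by rewrite gt_min; apply/orP; right; rewrite ltrD2l; lra.
have Sb : ubound S b by move=> x [/andP[]].
have hS : has_sup S by split=> //; exists b.
set m := sup S.
have am : a < m.
  case: S0 => x Sx; have [/andP[ax _] _] := Sx.
  by apply: (lt_le_trans ax); apply: ub_le_sup => //; exists b.
have mb : m <= b by apply: sup_le_ub => //; case: S0 => x; exists x.
have [|d d0' h] := Ploc m; first by rewrite ltW.
have [x Sx xm] := sup_adherent d0' hS.
have [/andP[ax xb] Pax] := Sx.
have xlem : x <= m by apply: ub_le_sup => //; exists b.
pose m' := Num.min b (m + d / 2).
have mm' : m <= m' by rewrite le_min mb lerDl ltW// divr_gt0.
have m'b : m' <= b by rewrite ge_min lexx.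
have m'd : m' < m + d by rewrite gt_min; apply/orP; right; rewrite ltrD2l; lra.
have Pam' : P a m'.
  have [xm'|] := ltP x m'; last by move=> m'x; suff <- : x = m' by []; apply/le_anti; rewrite m'x (le_trans xlem).
  apply: (Pcat _ x) => //.
  apply: h => //; exact: ltW.
have : m' <= m by apply: ub_le_sup; [exists b|split => //; rewrite m'b (lt_le_trans am)].
rewrite ge_min => /orP[bm|]; last by rewrite gerDl leNgt divr_gt0.
have <- : m' = b by apply/le_anti; rewrite m'b (le_trans bm).
by [].
Qed.

(** The sums that define [arc_length], by recursion on the subdivision. *)
Fixpoint vsum (d : R -> R -> R) (a : R) (s : seq R) : R :=
  if s is x :: s' then d a x + vsum d x s' else 0.

Lemma vsum_cat d a s1 s2 : vsum d a (s1 ++ s2) = vsum d a s1 + vsum d (last a s1) s2.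
Proof. by elim: s1 a => [a|x s ih a] /=; rewrite ?add0r// ih addrA. Qed.

Lemma big_vsum d z a s :
  \sum_(0 <= i < size s) d (nth z (a :: s) i) (nth z (a :: s) i.+1) = vsum d a s.
Proof.
elim: s a => [a|x s ih a] /=; first by rewrite big_geq.
by rewrite big_nat_recl//= -(ih x).
Qed.

Definition chord n (c : R -> 'rV[R[i]]_n) (s t : R) : R := enorm (c t - c s).

Lemma arc_lengthE n (c : R -> 'rV[R[i]]_n) :
  arc_length c = ereal_sup [set (vsum (chord c) 0 s)%:E | s in itv_partition 0 1].
Proof.
rewrite /arc_length; congr ereal_sup; apply/seteqP.
by split => x [s hs <-]; exists s => //; rewrite -(big_vsum _ 1) -?sumEFin// sumEFin.
Qed.

Lemma vsum_le n (c : R -> 'rV[R[i]]_n) (M : R -> R -> \bar R) (b : R) :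
  (forall s t : R, 0 <= s -> s < t -> t <= b -> ((chord c s t)%:E <= M s t)%E) ->
  (forall s t u : R, 0 <= s -> s < t -> t < u -> u <= b -> (M s t + M t u <= M s u)%E) ->
  forall s (a : R), 0 <= a -> a < b -> itv_partition a b s -> ((vsum (chord c) a s)%:E <= M a b)%E.
Proof.
move=> h1 h2; elim=> [a _ ab /itv_partition_nil ab'|x s ih a a0 ab hs].
  by rewrite ab' ltxx in ab.
have ax : a < x by case: hs => /= /andP[].
have hs' := itv_partition_cons hs; have xb := itv_partition_le hs'.
move: (xb); rewrite le_eqVlt => /predU1P[xb'|xb'].
  move: hs'; rewrite xb' => /itv_partitionxx -> /=.
  by rewrite addr0; apply: h1 => //; rewrite -xb'.
apply: le_trans (h2 a x b a0 ax xb' (lexx _)) => /=.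
by rewrite EFinD leeD ?h1// ih// (le_trans a0)// ltW.
Qed.

Lemma arc_length_le n (c : R -> 'rV[R[i]]_n) (M : R -> R -> \bar R) :
  (forall s t : R, 0 <= s -> s < t -> t <= 1 -> ((chord c s t)%:E <= M s t)%E) ->
  (forall s t u : R, 0 <= s -> s < t -> t < u -> u <= 1 -> (M s t + M t u <= M s u)%E) ->
  (arc_length c <= M 0%R 1%R)%E.
Proof.
move=> h1 h2; rewrite arc_lengthE; apply: ge_ereal_sup => _ [s hs <-].
by apply: vsum_le hs => //; exact: h1.
Qed.

Lemma vsum_chord_ge0 n (c : R -> 'rV[R[i]]_n) a s : 0 <= vsum (chord c) a s.
Proof. by elim: s a => //= x s ih a; rewrite addr_ge0 ?ih ?enorm_ge0. Qed.

Lemma vsum_le_arc_length n (c : R -> 'rV[R[i]]_n) s :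
  itv_partition 0 1 s -> ((vsum (chord c) 0%R s)%:E <= arc_length c)%E.
Proof. by move=> hs; rewrite arc_lengthE; apply: ereal_sup_ubound; exists s. Qed.

(** The two subdivisions are parts of one subdivision of [0, 1], which has in
    addition the chord from [t] to [u]. *)
Lemma vsum2_le_arc_length n (c : R -> 'rV[R[i]]_n) t u s1 s2 : t < u ->
  itv_partition 0 t s1 -> itv_partition u 1 s2 ->
  ((vsum (chord c) 0 s1 + vsum (chord c) u s2)%R%:E <= arc_length c)%E.
Proof.
move=> tu h1 h2.
have h : itv_partition 0 1 (s1 ++ (u :: s2)).
  apply: itv_partition_cat h1 _.
  by case: h2 => h3 h4; split => //=; rewrite tu.
apply: le_trans (vsum_le_arc_length c h).
rewrite lee_fin vsum_cat /= lerD2l.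
by rewrite lerDr enorm_ge0.
Qed.

Lemma zero_set_closed n (c : R -> 'rV[R[i]]_n) (s t : R) :
  {within `[s, t], continuous c} -> closed [set x | s <= x <= t /\ c x = 0].
Proof.
move=> /within_continuous_enormP hc; rewrite -openC openE => x /= xZ.
have [xst|xst] := boolP (s <= x <= t); last first.
  have xstC : (~` `[s, t]%classic) x by rewrite /= in_itv/=; exact/negP.
  have oC : open (~` `[s, t]%classic) by apply: closed_openC; exact: interval_closed.
  have := open_nbhs_nbhs (conj oC xstC).
  by apply: filterS => y; rewrite /= in_itv/= => yst [].
have cx : c x != 0 by apply/eqP => cx; exact: xZ.
have := hc x _ _ (enorm_gt0 cx); rewrite /= in_itv/= => /(_ xst).
apply: filterS => y; rewrite /= in_itv/= => h [yst cy].
by have := h yst; rewrite cy sub0r enormN ltxx.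
Qed.

Lemma first_zero n (c : R -> 'rV[R[i]]_n) (s t : R) :
  {within `[s, t], continuous c} -> (exists2 x, s <= x <= t & c x = 0) ->
  exists a, [/\ s <= a <= t, c a = 0 & forall x, s <= x -> x < a -> c x != 0].
Proof.
move=> hc [x0 x0st cx0]; set Z := [set x | s <= x <= t /\ c x = 0].
have Z0 : Z !=set0 by exists x0.
have lZ : has_lbound Z by exists s => x [/andP[]].
have [ist ci] : Z (inf Z).
  suff : closure Z (inf Z) by rewrite -(closure_id Z).1//; exact: zero_set_closed.
  move=> B /nbhs_ballP[e /= e0 eB].
  have [x Zx xe] := inf_adherent e0 (conj Z0 lZ).
  exists x; split => //; apply: eB; rewrite /ball/= distrC ger0_norm ?subr_ge0.
    by rewrite ltrBlDl.
  exact: ge_inf.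
exists (inf Z); split => // x sx xi; apply/eqP => cx.
have : inf Z <= x.
  apply: ge_inf => //; split => //; rewrite sx/= (le_trans (ltW xi))//.
  by case/andP: ist.
by rewrite leNgt xi.
Qed.

Lemma last_zero n (c : R -> 'rV[R[i]]_n) (s t : R) :
  {within `[s, t], continuous c} -> (exists2 x, s <= x <= t & c x = 0) ->
  exists b, [/\ s <= b <= t, c b = 0 & forall x, b < x -> x <= t -> c x != 0].
Proof.
move=> hc [x0 x0st cx0]; set Z := [set x | s <= x <= t /\ c x = 0].
have Z0 : Z !=set0 by exists x0.
have uZ : has_ubound Z by exists t => x [/andP[]].
have [ist ci] : Z (sup Z).
  suff : closure Z (sup Z) by rewrite -(closure_id Z).1//; exact: zero_set_closed.
  exact: closure_sup.
exists (sup Z); split => // x xi xt; apply/eqP => cx.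
have : x <= sup Z.
  apply: ub_le_sup => //; split => //; rewrite xt andbT (le_trans _ (ltW xi))//.
  by case/andP: ist.
by rewrite leNgt xi.
Qed.

End Subdivision.

Section ArcLengthLeMetricLength.
Local Open Scope complex_scope.
Context {R : realType}.
Notation mu := (@lebesgue_measure R).

(** [U] is the union of the countably many intervals with rational ends that are
    contained in [U] and on which [f] is measurable. *)
Lemma measurable_fun_locally (U : set R) (f : R -> \bar R) :
  (forall x, U x -> exists a b : R, [/\ a < x < b, `]a, b[%classic `<=` U &
     measurable_fun `]a, b[ f]) -> measurable_fun U f.
Proof.
move=> h.
pose E (n : nat) : set R := if unpickle n is Some (p, q) then
    [set x | ratr p < x < ratr q /\
       `]ratr p, ratr q[%classic `<=` U /\ measurable_fun (`]ratr p, ratr q[ : set R) f]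
  else set0.
have EP n : E n = set0 \/ exists a b : R,
    [/\ E n = `]a, b[%classic, `]a, b[%classic `<=` U & measurable_fun `]a, b[ f].
  rewrite /E; case: (unpickle n) => [[p q]|]; last by left.
  have [hpq|hpq] := pselect (`]ratr p, ratr q[%classic `<=` U /\
      measurable_fun (`]ratr p, ratr q[ : set R) f); [right|left].
    exists (ratr p), (ratr q); case: (hpq) => h1 h2; split => //.
    by apply/seteqP; split => x /=; rewrite in_itv/=; [case|move=> ?].
  by apply/seteqP; split => x //= [_ /hpq].
have -> : U = \bigcup_n E n.
  apply/seteqP; split => [x Ux|x [n _]]; last first.
    by have [->//|[a [b [-> + _]]]] := EP n; exact.
  have [a [b [/andP[ax xb] abU mf]]] := h x Ux.
  have [p] := rat_in_itvoo ax; rewrite in_itv/= => /andP[ap px].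
  have [q] := rat_in_itvoo xb; rewrite in_itv/= => /andP[xq qb].
  have sub : `]ratr p, ratr q[ `<=` (`]a, b[%classic : set R).
    move=> y /=; rewrite !in_itv/= => /andP[py yq].
    by rewrite (lt_trans ap py) (lt_trans yq qb).
  exists (pickle (p, q)); [exact: I|rewrite /E pickleK; split; first by rewrite px].
  split.
    exact: subset_trans sub abU.
  exact: measurable_funS sub mf.
apply/measurable_fun_bigcup => [n|n].
  by have [->//|[a [b [->]]]] := EP n.
by have [->|[a [b [-> _ ?]]]] := EP n => //; exact: measurable_fun_set0.
Qed.

Variables (n k m : nat) (f : 'rV[R[i]]_n -> 'rV[R[i]]_k) (g : 'rV[R[i]]_n -> 'rV[R[i]]_m).
Variables (c : R -> 'rV[R[i]]_n) (C : R).
Hypothesis C0 : 0 <= C.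
Hypothesis cc : {within `[0, 1], continuous c}.
Hypothesis cpw : forall a b : R, 0 <= a -> a < b -> b <= 1 ->
  (forall t, a <= t <= b -> c t != 0) -> pwC1 c a b.
Hypothesis hf : forall t : R, 0 <= t <= 1 -> holomorphic_at f (c t).
Hypothesis hg : forall t : R, 0 <= t <= 1 -> holomorphic_at g (c t).
Hypothesis gC : forall (t : R) v, 0 < t < 1 -> c t != 0 -> has_velocity c t v ->
  enorm ('d g (c t) v) <= C * enorm ('d f (c t) v).

Let h t := (pullback_norm f (c t) (velocity c t))%:E.

Let A (s t : R) : set R := `]s, t[%classic `&` [set x | c x != 0].

Let h0 t : (0 <= h t)%E. Proof. by rewrite lee_fin enorm_ge0. Qed.

Let A_measurable (s t : R) : 0 <= s -> t <= 1 -> measurable (A s t).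
Proof.
move=> s0 t1.
have -> : A s t = `]s, t[%classic `\` [set x | 0 <= x <= 1 /\ c x = 0].
  apply/seteqP; split => x /= [xst cx]; split => //=.
    by move=> [_ /eqP]; rewrite (negbTE cx).
  apply/eqP => cx0; apply: cx; split => //.
  move: xst; rewrite in_itv/= => /andP[sx xt].
  by rewrite (le_trans s0 (ltW sx)) (le_trans (ltW xt)).
by apply: measurableD => //; apply: closed_measurable; exact: zero_set_closed.
Qed.

Let continuous_c (x e : R) : 0 <= x <= 1 -> 0 < e ->
  exists2 d : R, 0 < d & forall y : R, 0 <= y <= 1 -> `|y - x| < d -> enorm (c y - c x) < e.
Proof.
move=> x01 e0; move/within_continuous_enormP : cc => /(_ x _ e e0).
rewrite /= in_itv/= => /(_ x01) /nbhs_ballP[d /= d0 hd]; exists d => // y y01 yx.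
by apply: hd; rewrite ?in_itv//= /ball/= distrC.
Qed.

Let continuous_gc (x e : R) : 0 <= x <= 1 -> 0 < e ->
  exists2 d : R, 0 < d & forall y : R, 0 <= y <= 1 -> `|y - x| < d -> enorm (g (c y) - g (c x)) < e.
Proof.
move=> x01 e0; have := holomorphic_at_continuous (hg x01).
move=> /cvg_enormP/(_ _ e0)/nbhs_enormP[e1 e10 he1].
have [d d0 hd] := continuous_c x01 e10; exists d => // y y01 yx.
by apply: he1; exact: hd.
Qed.

Let h_measurable (s t : R) : 0 <= s -> t <= 1 -> measurable_fun (A s t) h.
Proof.
move=> s0 t1; apply: measurable_fun_locally => x [/= + cx].
rewrite in_itv/= => /andP[sx xt].
have x01 : 0 <= x <= 1 by rewrite (le_trans s0 (ltW sx)) (le_trans (ltW xt)).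
have [d d0 hd] := continuous_c x01 (enorm_gt0 cx).
pose r := Num.min (d / 2) (Num.min ((x - s) / 2) ((t - x) / 2)).
have r0 : 0 < r by rewrite !lt_min !divr_gt0 ?subr_gt0.
have rd : r <= d / 2 by rewrite !ge_min lexx.
have rs : r <= (x - s) / 2 by rewrite !ge_min lexx orbT.
have rt : r <= (t - x) / 2 by rewrite !ge_min lexx !orbT.
have near0 y : x - r <= y <= x + r -> c y != 0.
  move=> /andP[y1 y2]; apply/eqP => cy.
  suff : enorm (c y - c x) < enorm (c x) by rewrite cy sub0r enormN ltxx.
  apply: hd; first by apply/andP; split; lra.
  by rewrite ltr_norml; apply/andP; split; lra.
exists (x - r), (x + r); split.
- by apply/andP; split; lra.
- move=> y /=; rewrite in_itv/= => /andP[y1 y2]; split => /=.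
    by rewrite in_itv/=; apply/andP; split; lra.
  by apply: near0; rewrite !ltW.
- apply: speed_measurable; first by apply: cpw => //; lra.
  by move=> y /andP[y1 y2]; apply: hf; apply/andP; split; lra.
Qed.

(** The curve [c] may vanish at [x] and at [y], hence need not be piecewise C^1 up
    to the ends; both ends are approached from inside. *)
Let run (x y : R) : 0 <= x -> x < y -> y <= 1 -> (forall t, x < t < y -> c t != 0) ->
  ((chord (g \o c)%FUN x y)%:E <= C%:E * \int[mu]_(t in A x y) h t)%E.
Proof.
move=> x0 xy y1 cxy.
have Axy : A x y = `]x, y[%classic.
  apply/seteqP; split => [z []//|z zxy]; split => //.
  by apply: cxy; move: zxy; rewrite /= in_itv.
apply/lee_addgt0Pr => e e0.
have [||d1 d10 hd1] := @continuous_gc x (e / 2); [by rewrite x0 ltW ?(lt_le_trans xy)|by lra|].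
have [||d2 d20 hd2] := @continuous_gc y (e / 2); [by rewrite y1 andbT ltW ?(le_lt_trans x0)|by lra|].
pose r := Num.min ((y - x) / 3) (Num.min (d1 / 2) (d2 / 2)).
have r0 : 0 < r by rewrite !lt_min !divr_gt0 ?subr_gt0.
have r1 : r <= (y - x) / 3 by rewrite !ge_min lexx.
have r2 : r <= d1 / 2 by rewrite !ge_min lexx orbT.
have r3 : r <= d2 / 2 by rewrite !ge_min lexx !orbT.
have xy' : x + r < y - r by lra.
have D1 : enorm (g (c (x + r)) - g (c x)) < e / 2.
  apply: hd1; first by apply/andP; split; lra.
  by rewrite addrAC subrr add0r ger0_norm; lra.
have D2 : enorm (g (c (y - r)) - g (c y)) < e / 2.
  apply: hd2; first by apply/andP; split; lra.
  by rewrite addrAC subrr add0r normrN ger0_norm; lra.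
have D : ((enorm (g (c (y - r)) - g (c (x + r))))%:E <= C%:E * \int[mu]_(t in `](x + r)%R, (y - r)%R[) h t)%E.
  apply: pwC1_length_ge => //.
  - apply: cpw => [||| t /andP[t1 t2]]; [lra|exact: xy'|lra|].
    by apply: cxy; apply/andP; split; lra.
  - by move=> t /andP[t1 t2]; apply: hf; apply/andP; split; lra.
  - by move=> t /andP[t1 t2]; apply: hg; apply/andP; split; lra.
  - move=> t v /andP[t1 t2]; apply: gC; first by apply/andP; split; lra.
    by apply: cxy; apply/andP; split; lra.
apply: (@le_trans _ _ ((enorm (g (c (y - r)) - g (c (x + r))))%:E + e%:E)%E).
  rewrite -EFinD lee_fin /chord /=.
  have := ler_enorm_dist (g (c y)) (g (c (y - r))) (g (c x)).
  have := ler_enorm_dist (g (c (y - r))) (g (c (x + r))) (g (c x)).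
  rewrite (enormBC (g (c y)) (g (c (y - r)))); lra.
rewrite leeD2r// (le_trans D)// lee_wpmul2l ?lee_fin//.
rewrite Axy; apply: ge0_subset_integral => //.
  by rewrite -Axy; apply: h_measurable.
move=> z /=; rewrite !in_itv/= => /andP[z1 z2]; apply/andP; split; lra.
Qed.

Let A_super (s t u v : R) : 0 <= s -> t <= u -> v <= 1 -> s <= t -> u <= v ->
  (C%:E * (\int[mu]_(x in A s t) h x) + C%:E * (\int[mu]_(x in A u v) h x) <=
   C%:E * \int[mu]_(x in A s v) h x)%E.
Proof.
move=> s0 tu v1 st uv.
have t1 : t <= 1 by lra.
have u0 : 0 <= u by lra.
rewrite -ge0_muleDr ?integral_ge0// lee_wpmul2l ?lee_fin//.
have sub1 : A s t `<=` A s v.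
  move=> z [/= + cz]; rewrite in_itv/= => /andP[sz zt]; split => //=.
  by rewrite in_itv/= sz /=; lra.
have sub2 : A u v `<=` A s v.
  move=> z [/= + cz]; rewrite in_itv/= => /andP[sz zt]; split => //=.
  by rewrite in_itv/= zt andbT; lra.
have mA1 := A_measurable s0 t1; have mA2 := A_measurable u0 v1.
have sub : A s t `|` A u v `<=` A s v by rewrite subUset.
rewrite -ge0_integral_setU//.
- apply: ge0_subset_integral => //; first exact: measurableU.
    exact: A_measurable.
  exact: h_measurable.
- by apply: measurable_funS sub _; [exact: A_measurable|exact: h_measurable].
- apply/disj_setPS => z [[/= + _] [/= + _]]; rewrite !in_itv/= => /andP[_ zt] /andP[uz _].
  by move: (lt_trans uz zt); rewrite ltNge tu.
Qed.

(** If [c] has zeros in [[s, t]], then [g \o c] takes the same value at the first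
    and at the last of them, and the chord is bounded by the lengths of the two
    outer parts, on which [c] has no zero. *)
Let increment (s t : R) : 0 <= s -> s < t -> t <= 1 ->
  ((chord (g \o c)%FUN s t)%:E <= C%:E * \int[mu]_(x in A s t) h x)%E.
Proof.
move=> s0 st t1.
have Mge0 x y : (0 <= C%:E * \int[mu]_(z in A x y) h z)%E.
  by rewrite mule_ge0// ?lee_fin// integral_ge0.
have cst : {within `[s, t], continuous c}.
  apply: continuous_subspaceW cc => z /=; rewrite !in_itv/= => /andP[z1 z2].
  by apply/andP; split; lra.
have [Z|NZ] := pselect (exists2 x, s <= x <= t & c x = 0); last first.
  apply: run => // x /andP[/ltW sx /ltW xt]; apply/eqP => cx; apply: NZ.
  by exists x; rewrite ?sx.
have [a [/andP[sa at'] ca ha]] := first_zero cst Z.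
have [b [/andP[sb bt] cb hb]] := last_zero cst Z.
have ab : a <= b.
  by rewrite leNgt; apply/negP => ba; have := hb a ba at'; rewrite ca eqxx.
apply: le_trans (@A_super s a b t s0 ab t1 sa bt).
apply: (@le_trans _ _ ((chord (g \o c)%FUN s a)%:E + (chord (g \o c)%FUN b t)%:E)%E).
  rewrite -EFinD lee_fin /chord /= ca cb [leRHS]addrC.
  exact: ler_enorm_dist.
apply: leeD.
  move: sa; rewrite le_eqVlt => /predU1P[<-|sa].
    by rewrite /chord subrr enorm0.
  apply: run => // [|z /andP[/ltW sz za]]; first by lra.
  exact: ha.
move: bt; rewrite le_eqVlt => /predU1P[<-|bt].
  by rewrite /chord subrr enorm0.
apply: run => // [|z /andP[bz /ltW zt]]; first by lra.
exact: hb.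
Qed.

(** The integrals of the speed over the nonzero parts of intervals are
    superadditive and dominate each chord. *)
Lemma arc_length_le_metric_length :
  (arc_length (g \o c)%FUN <= C%:E * metric_length f c)%E.
Proof.
apply: (@le_trans _ _ (C%:E * \int[mu]_(x in A 0 1) h x)%E).
  apply: (@arc_length_le _ _ _ (fun s t => C%:E * \int[mu]_(x in A s t) h x)%E).
    exact: increment.
  by move=> s t u s0 st tu u1; apply: A_super => //; lra.
rewrite lee_wpmul2l ?lee_fin//.
rewrite /metric_length.
have mA : measurable (A 0 1) by exact: A_measurable.
have sub : `[0, 1]%classic `&` [set s | c s != 0] `<=` [set 0] `|` ([set 1] `|` A 0 1).
  move=> z [/= + cz]; rewrite in_itv/= => /andP[].
  rewrite le_eqVlt => /predU1P[<- _|z0]; first by left.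
  rewrite le_eqVlt => /predU1P[->|z1]; right; [by left|right].
  by split => //=; rewrite in_itv/= z0.
apply: ge0_subset_integral => //.
- rewrite [X in measurable X](_ : _ = `[0, 1]%classic `\` [set x | 0 <= x <= 1 /\ c x = 0]).
    by apply: measurableD => //; apply: closed_measurable; exact: zero_set_closed.
  apply/seteqP; split => x /= [x01 cx]; split => //=.
    by move=> [_ /eqP]; rewrite (negbTE cx).
  by apply/eqP => cx0; apply: cx; split => //; move: x01; rewrite in_itv.
- apply: measurable_funS sub _.
    by apply: measurableU => //; apply: measurableU.
  apply/measurable_funU => //; first by apply: measurableU.
  split; first exact: measurable_fun_set1.
  apply/measurable_funU => //; split; first exact: measurable_fun_set1.
  exact: h_measurable.
- move=> z [/= + cz]; rewrite in_itv/= => /andP[/ltW z0 /ltW z1]; split => //=.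
  by rewrite in_itv/= z0.
Qed.

End ArcLengthLeMetricLength.

(** * Short curves in a chart *)

Section Tangent.
Local Open Scope complex_scope.
Context {R : realType}.

Lemma row1_continuous : continuous (fun a : R[i] => \row_(j < 1) a).
Proof.
move=> a; apply/(@cvg_enormP _ _ _ (nbhs a) (nbhs_filter a)) => e e0; apply/nbhs_normcP; exists e => // b ba.
apply: le_lt_trans (enorm_le_sum _) _.
by rewrite big_ord_recl big_ord0 addr0 !mxE.
Qed.

(** A function that vanishes on [X] is zero along [c], so its differential kills
    the velocity of [c]. *)
Lemma velocity_tangent n (X : set 'rV[R[i]]_n) (c : R -> 'rV[R[i]]_n) t v :
  (\forall s \near t, X (c s)) -> has_velocity c t v -> tangent_space X (c t) v.
Proof.
move=> Xc hc h hh hX.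
have lin : linear (fun a : R[i] => \row_(j < 1) a : 'rV[R[i]]_1).
  by move=> a x y; apply/rowP => j; rewrite !mxE.
pose linM := GRing.isLinear.Build _ _ _ _ _ lin.
pose L : {linear R[i] -> 'rV[R[i]]_1} :=
  HB.pack (fun a : R[i] => \row_(j < 1) a : 'rV[R[i]]_1) linM.
have cL : continuous L by exact: row1_continuous.
have dh := holomorphic_at_differentiable hh.
have dL : differentiable L (h (c t)) by exact: linear_differentiable.
have hv : has_velocity ((L \o h) \o c) t ('d (L \o h) (c t) v).
  by apply: has_velocity_comp hc; exact: differentiable_comp.
have : has_velocity ((L \o h) \o c) t 0.
  move=> e e0; have cc := has_velocity_continuous hc.
  have h0 : \forall s \near t, h (c s) = 0.
    by have := cc _ hX; move: Xc; apply: filterS2 => s Xs; exact.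
  have ht := nbhs_singleton h0.
  apply: filterS h0 => s hs; rewrite /= hs ht subrr scaler0 subrr enorm0.
  by rewrite mulr_ge0// ltW.
move=> /has_velocity_velocity; rewrite (has_velocity_velocity hv).
rewrite (diff_comp dh dL) /comp (diff_lin _ cL) => /rowP/(_ 0).
by rewrite !mxE.
Qed.

Lemma has_velocity_line n (z w : 'rV[R[i]]_n) (u : R -> R) (t du : R) :
  is_derive t 1 u du -> has_velocity (fun s => z + (u s)%:C *: w) t (du%:C *: w).
Proof.
move=> hu e e0; have w1 : 0 < 1 + enorm w by rewrite ltr_pwDl ?enorm_ge0.
have := is_derive_approxP hu (divr_gt0 e0 w1); apply: filterS => s hs.
rewrite (_ : _ - _ = (u s - u t - (s - t) * du)%:C *: w); last first.
  by apply/rowP => j; rewrite !mxE !rmorphB rmorphM /=; ring.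
rewrite enormZR (le_trans (ler_wpM2r (enorm_ge0 _) hs))//.
rewrite [leLHS](_ : _ = e * `|s - t| * (enorm w / (1 + enorm w))); last first.
  by field; exact: lt0r_neq0.
have [->|st] := eqVneq s t; first by rewrite subrr normr0 !mulr0 mul0r.
rewrite ger_pMr ?mulr_gt0 ?normr_gt0 ?subr_eq0//.
by rewrite ler_pdivrMr// mul1r lerDr.
Qed.

(** A smooth step from 0 at 0 to 1 at 1 which stays in the unit interval on all of
    R: run at this pace, a segment is a C^1 curve defined on all of R, as
    [C1_curve] demands, which does not leave the segment. *)
Definition ease (x : R) : R := (1 - cos (pi * x)) / 2.
Definition dease (x : R) : R := pi / 2 * sin (pi * x).

Lemma ease_itv (x : R) : 0 <= ease x <= 1.
Proof.
rewrite /ease; have := cos_le1 (pi * x); have := cos_geN1 (pi * x) => h1 h2.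
by apply/andP; split; lra.
Qed.

Lemma ease0 : ease 0 = 0. Proof. by rewrite /ease mulr0 cos0 subrr mul0r. Qed.
Lemma ease1 : ease 1 = 1. Proof. by rewrite /ease mulr1 cospi; field. Qed.

Lemma is_derive_ease (s t x : R) :
  is_derive x 1 (fun x => ease ((x - s) / (t - s))) (dease ((x - s) / (t - s)) / (t - s)).
Proof.
pose u (y : R) := pi * ((y - s) / (t - s)).
have du : is_derive x 1 u (pi / (t - s)).
  rewrite /u (_ : (fun _ => _) = (fun y => (pi / (t - s)) * (y - s))).
    by apply: is_derive_eq; rewrite subr0 /GRing.scale /= mulr1.
  by apply/funext => y; rewrite mulrA mulrAC.
have dc : is_derive x 1 (cos \o u) (- sin (u x) * (pi / (t - s))).
  exact: is_derive1_comp.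
rewrite /ease (_ : (fun _ => _) = (fun y => 2^-1 * (1 - (cos \o u) y))).
  by apply: is_derive_eq; rewrite /dease /GRing.scale /= -/(u x); ring.
by apply/funext => y; rewrite mulrC.
Qed.

End Tangent.

Section ChartSegments.
Local Open Scope complex_scope.
Context {R : realType}.
Notation mu := (@lebesgue_measure R).

Definition ease_in (s t x : R) : R := ease ((x - s) / (t - s)).
Definition dease_in (s t x : R) : R := dease ((x - s) / (t - s)) / (t - s).

Lemma dease_in_continuous (s t : R) : continuous (dease_in s t).
Proof.
move=> x; apply: cvgM; last exact: cvg_cst.
apply: cvgM; first exact: cvg_cst.
apply: continuous_comp; last exact: continuous_sin.
apply: cvgM; first exact: cvg_cst.
apply: cvgM; last exact: cvg_cst.
by apply: cvgB; [exact: cvg_id|exact: cvg_cst].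
Qed.

Lemma dease_in_ge0 (s t x : R) : s < t -> s <= x <= t -> 0 <= dease_in s t x.
Proof.
move=> st /andP[sx xt]; have ts : 0 < t - s by rewrite subr_gt0.
have q0 : 0 <= (x - s) / (t - s) by apply: divr_ge0; [rewrite subr_ge0|exact: ltW].
have q1 : (x - s) / (t - s) <= 1 by rewrite ler_pdivrMr// mul1r lerD2r.
apply: divr_ge0; last exact: ltW.
have p0 := pi_ge0 R.
apply: mulr_ge0; first by apply: divr_ge0.
apply: sin_ge0_pi; apply/andP; split; first by apply: mulr_ge0.
by rewrite ger_pMr// pi_gt0.
Qed.

Lemma integral_dease_in (s t M : R) : s < t ->
  (\int[mu]_(x in `]s, t[) (M * dease_in s t x)%:E = M%:E)%E.
Proof.
move=> st; have ts : t - s != 0 by rewrite subr_eq0 gt_eqF.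
have dF (x : R) : is_derive x 1 (fun x => M * ease_in s t x) (M * dease_in s t x).
  by have := is_derive_ease s t x => h; apply: is_derive_eq.
have cont : continuous (fun x => M * dease_in s t x).
  by move=> x; apply: cvgMr; exact: dease_in_continuous.
have cF : continuous (fun x => M * ease_in s t x).
  by move=> x; apply/differentiable_continuous/derivable1_diffP; have [] := dF x.
rewrite -(@integral_itv_bndoo _ _ _ _ true false); last first.
  apply/measurable_EFinP; apply: measurable_funTS.
  exact: continuous_measurable_fun.
rewrite (@continuous_FTC2 _ _ (fun x => M * ease_in s t x))//.
- rewrite -EFinB /ease_in subrr mul0r ease0 divff// ease1.
  by rewrite mulr0 mulr1 subr0.
- by apply: continuous_subspaceT.
- split=> [x _||].
  + by have [] := dF x.
  + by apply: cvg_at_right_filter; exact: cF.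
  + by apply: cvg_at_left_filter; exact: cF.
- by move=> x _; rewrite derive1E; have [] := dF x.
Qed.

(** An injective linear map has a linear left inverse, and linear maps are
    bounded. *)
Lemma injective_linear_bound n m (L : {linear 'rV[R[i]]_n -> 'rV[R[i]]_m}) :
  (forall w, L w = 0 -> w = 0) ->
  exists2 C : R, 0 < C & forall w, enorm w <= C * enorm (L w).
Proof.
move=> Li; pose M := lin1_mx L.
have LM w : L w = w *m M by rewrite mul_rV_lin1.
have Mfree : row_free M.
  rewrite -kermx_eq0; apply/eqP/row_matrixP => i; rewrite row0.
  apply: Li; rewrite LM -row_mul mulmx_ker.
  exact: row0.
have [C C0 hC] := linear_enorm_bound (mulmxr (pinvmx M) : {linear 'rV[R[i]]_m -> 'rV[R[i]]_n}).
exists C => // w; have := hC (L w).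
by rewrite /= LM -mulmxA mulmxVp// mulmx1.
Qed.

End ChartSegments.

Section ChartLemma.
Local Open Scope complex_scope.
Context {R : realType}.
Notation mu := (@lebesgue_measure R).

Lemma near_continuous (T U : topologicalType) (f : T -> U) x (P : set U) :
  {for x, continuous f} -> nbhs (f x) P -> \forall z \near x, P (f z).
Proof. by move=> fc /fc. Qed.

Lemma open_enorm_ball n (r : R) : open [set z : 'rV[R[i]]_n | enorm z < r].
Proof.
rewrite openE => z /= zr; apply/nbhs_enormP; exists (r - enorm z).
  by rewrite subr_gt0.
by move=> y; have := ler_enorm_sub y z => /=; lra.
Qed.

Lemma enorm_segment n (z0 z1 : 'rV[R[i]]_n) (r a : R) :
  enorm z0 < r -> enorm z1 < r -> 0 <= a <= 1 ->
  enorm (z0 + a%:C *: (z1 - z0)) < r.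
Proof.
move=> h0 h1 /andP[a0 a1].
have -> : z0 + a%:C *: (z1 - z0) = (1 - a)%:C *: z0 + a%:C *: z1.
  by apply/rowP => j; rewrite !mxE rmorphB /=; ring.
rewrite (le_lt_trans (ler_enormD _ _))// !enormZR !ger0_norm ?subr_ge0//.
pose M := Num.max (enorm z0) (enorm z1).
have M0 : enorm z0 <= M by rewrite le_max lexx.
have M1 : enorm z1 <= M by rewrite le_max lexx orbT.
have Mr : M < r by rewrite gt_max h0.
apply: le_lt_trans Mr.
have := ler_wpM2l a0 M1; have : 0 <= 1 - a by rewrite subr_ge0.
move=> /ler_wpM2l/(_ _ _ M0); lra.
Qed.

(** The mean value theorem for the component of [H] in the direction of
    [A 0 (z1 - z0)], which varies at a rate close to the norm of that vector. *)
Lemma mean_value_lower n m (H : 'rV[R[i]]_n -> 'rV[R[i]]_m)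
    (A : 'rV[R[i]]_n -> {linear 'rV[R[i]]_n -> 'rV[R[i]]_m}) (z0 z1 : 'rV[R[i]]_n) (d : R) :
  (forall a : R, 0 <= a <= 1 ->
     has_velocity (fun s => H (z0 + s%:C *: (z1 - z0))) a (A (z0 + a%:C *: (z1 - z0)) (z1 - z0))) ->
  (forall a : R, 0 <= a <= 1 ->
     enorm (A (z0 + a%:C *: (z1 - z0)) (z1 - z0) - A 0 (z1 - z0)) <= d * enorm (A 0 (z1 - z0))) ->
  (1 - d) * enorm (A 0 (z1 - z0)) <= enorm (H z1 - H z0).
Proof.
move=> hH hA; set w := z1 - z0 in hH hA *; set v := A 0 w in hA *.
have [v0|v0] := eqVneq v 0; first by rewrite v0 enorm0 mulr0 enorm_ge0.
have {}v0 := enorm_gt0 v0.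
pose psi (a : R) := rdot (H (z0 + a%:C *: w)) v.
pose dpsi (a : R) := rdot (A (z0 + a%:C *: w) w) v.
have dP (a : R) : 0 <= a <= 1 -> is_derive a 1 psi (dpsi a).
  by move=> /hH /(has_velocity_rdot v).
have [a||a a01 E] := @MVT R psi dpsi 0 1 ltr01.
- by rewrite in_itv/= => /andP[/ltW a0 /ltW a1]; apply: dP; rewrite a0.
- apply: continuous_in_subspaceT => a; rewrite inE/= in_itv/= => /dP[h _].
  by apply/differentiable_continuous/derivable1_diffP.
have {}a01 : 0 <= a <= 1.
  by move: a01; rewrite in_itv/= => /andP[/ltW -> /ltW ->].
have lower : (1 - d) * enorm v * enorm v <= dpsi a.
  rewrite /dpsi -[A _ w](subrK v) rdotDl rdotvv.
  have := rdot_le (- (A (z0 + a%:C *: w) w - v)) v.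
  rewrite rdotNl enormN => h1.
  have := le_trans h1 (ler_wpM2r (ltW v0) (hA _ a01)).
  by move=> h2; rewrite expr2 mulrBl mul1r mulrBl [leRHS]addrC lerD2l lerNl.
have upper : dpsi a <= enorm (H z1 - H z0) * enorm v.
  apply: le_trans (rdot_le _ _); rewrite rdotBl.
  move: E; rewrite subr0 mulr1 => <-; rewrite /psi.
  rewrite (_ : z0 + 1%:C *: w = z1); last by rewrite scale1r /w [z0 + _]addrC subrK.
  by rewrite (_ : z0 + 0%:C *: w = z0)// scale0r addr0.
by rewrite -(ler_pM2r v0) (le_trans lower).
Qed.

(** Near the centre of a chart [phi], the differential of [G \o phi] is uniformly
    close to an injective linear map [A 0]. The speed of a segment of direction [w]
    is therefore at most (1 + d) times the norm of [A 0 w], and the chord of its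
    image at least (1 - d) times that norm. *)
Lemma chart_segments N m (X U : set 'rV[R[i]]_N) (G : 'rV[R[i]]_N -> 'rV[R[i]]_m)
    p (eps : R) :
  regular_at X p -> holomorphic_at G p ->
  (forall u, tangent_space X p u -> 'd G p u = 0 -> u = 0) ->
  nbhs p U -> 0 < eps ->
  exists2 O, nbhs p O & forall x y (s t : R), X x -> O x -> X y -> O y -> s < t ->
    exists e, [/\ C1_curve e, e s = x /\ e t = y,
      forall tau, X (e tau) /\ U (e tau)
    & forall k (F : 'rV[R[i]]_N -> 'rV[R[i]]_k),
        (forall tau, holomorphic_at F (e tau)) ->
        (forall tau v, enorm ('d F (e tau) v) <= enorm ('d G (e tau) v)) ->
        (\int[mu]_(tau in `]s, t[) (pullback_norm F (e tau) (velocity e tau))%:E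
           <= ((1 + eps) * enorm (G y - G x))%:E)%E].
Proof.
move=> [D [phi [[oD D0] phi0 hD _ openphi]]] hG Gi pU eps0.
have [h0 inj0] := hD 0 D0.
have phic := holomorphic_at_continuous h0.
have phiX z : D z -> X (phi z).
  have [W' [_ E]] := openphi D oD (@subset_refl _ D).
  by move=> Dz; have : (phi @` D) (phi z) by [exists z]; rewrite E => -[].
pose A z : {linear 'rV[R[i]]_2 -> 'rV[R[i]]_m} := 'd G (phi z) \o 'd phi z.
have nD : nbhs (0 : 'rV[R[i]]_2) D by exact: open_nbhs_nbhs.
have Acvg w : A z w @[z --> (0 : 'rV[R[i]]_2)] --> A 0 w.
  have hG0 : holomorphic_at G (phi 0) by rewrite phi0.
  apply: (diff_cvg hG0 phic); exact: holomorphic_at_diff_continuous.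
have Ainj w : A 0 w = 0 -> w = 0.
  rewrite /A /= phi0 => Aw; apply: inj0; rewrite linear0; apply: Gi Aw.
  have hl := @has_velocity_line _ _ 0 w id 0 1 (is_derive_id _ _).
  have hc : has_velocity (phi \o (fun s : R => 0 + s%:C *: w)) 0 ('d phi 0 w).
    have := @has_velocity_comp _ _ _ phi (fun s : R => 0 + s%:C *: w) 0 (1%:C *: w).
    rewrite /= !scale0r addr0 scale1r; apply; first exact: holomorphic_at_differentiable.
    by move: hl; rewrite scale1r.
  have := @velocity_tangent _ _ X _ _ _ _ hc.
  rewrite /= scale0r addr0 phi0; apply.
  have lc := has_velocity_continuous hl.
  have D0' : nbhs (0 + (0 : R)%:C *: w) D by rewrite scale0r addr0.
  have lD : \forall s \near (0 : R), D (0 + s%:C *: w) by exact: (near_continuous lc D0').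
  by apply: filterS lD => s; exact: phiX.
have [C C0 hC] := injective_linear_bound Ainj.
(* The solution of 1 + d = (1 + eps) * (1 - d). *)
pose d := eps / (2 + eps).
have e2 : 0 < 2 + eps by rewrite addr_gt0.
have d0 : 0 < d by rewrite divr_gt0.
have [r r0 hr] : exists2 r : R, 0 < r & forall z : 'rV[R[i]]_2, enorm z < r ->
    [/\ D z, U (phi z), holomorphic_at G (phi z) &
        forall w, enorm (A z w - A 0 w) <= d * enorm (A 0 w)].
  have nU : nbhs (phi 0) U by rewrite phi0.
  have nG : nbhs (phi 0) (holomorphic_at G) by rewrite phi0; exact: holomorphic_at_near.
  have phiU : \forall z \near (0 : 'rV[R[i]]_2), U (phi z) by exact: (near_continuous phic nU).
  have phiG : \forall z \near (0 : 'rV[R[i]]_2), holomorphic_at G (phi z).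
    by exact: (near_continuous phic nG).
  have : \forall z \near (0 : 'rV[R[i]]_2), [/\ D z, U (phi z), holomorphic_at G (phi z) &
        forall w, enorm (A z w - A 0 w) <= d * enorm (A 0 w)].
    near=> z; split.
    - by near: z.
    - by near: z.
    - by near: z.
    - move=> w; apply: (@le_trans _ _ (d / C * enorm w)).
        by move: w; near: z; apply: linear_family_cvg => //; exact: divr_gt0.
      by rewrite mulrAC -mulrA ler_pM2l// ler_pdivrMr// mulrC.
  move=> /nbhs_enormP[r r0 hr]; exists r; first exact: r0.
  move=> z zr; apply: hr.
  rewrite subr0; exact: zr.
pose B := [set z : 'rV[R[i]]_2 | enorm z < r].
have BD : B `<=` D by move=> z /hr[].
have [V [oV BV]] := openphi B (@open_enorm_ball _ r) BD.
have B0 : B 0 by rewrite /B /= enorm0.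
exists V.
  apply: open_nbhs_nbhs; split => //.
  by have : (phi @` B) p by [exists 0]; rewrite BV => -[].
move=> x y s t Xx Vx Xy Vy st.
have [z0 z0r xE] : (phi @` B) x by rewrite BV.
have [z1 z1r yE] : (phi @` B) y by rewrite BV.
set w := z1 - z0.
have Br a : 0 <= a <= 1 -> enorm (z0 + a%:C *: w) < r by exact: enorm_segment.
have key z : enorm z < r -> enorm (A z w) <= (1 + eps) * enorm (G y - G x).
  move=> zr; have lower : (1 - d) * enorm (A 0 w) <= enorm (G y - G x).
    rewrite -xE -yE -/((G \o phi) z1) -/((G \o phi) z0).
    apply: mean_value_lower => a a01; last by have [_ _ _] := hr _ (Br a a01); exact.
    have [Dz _ Gz _] := hr _ (Br a a01); have [hz _] := hD _ Dz.
    have hl := @has_velocity_line _ _ z0 w id a 1 (is_derive_id _ _).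
    rewrite scale1r in hl.
    have := has_velocity_comp (holomorphic_at_differentiable hz) hl.
    by move=> /(has_velocity_comp (holomorphic_at_differentiable Gz)).
  have upper : enorm (A z w) <= (1 + d) * enorm (A 0 w).
    have [_ _ _ hz] := hr z zr.
    by rewrite mulrDl mul1r -lerBlDl (le_trans (ler_enorm_sub _ _)).
  apply: (le_trans upper).
  have -> : 1 + d = (1 + eps) * (1 - d) by rewrite /d; field; exact: lt0r_neq0.
  by rewrite -mulrA ler_pM2l// addr_gt0.
pose zt tau := z0 + (ease_in s t tau)%:C *: w.
have zr tau : enorm (zt tau) < r by apply: Br; exact: ease_itv.
pose e := phi \o zt.
pose v tau := 'd phi (zt tau) ((dease_in s t tau)%:C *: w).
have hzt tau : has_velocity zt tau ((dease_in s t tau)%:C *: w).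
  by apply: has_velocity_line; exact: is_derive_ease.
have hphi tau : holomorphic_at phi (zt tau).
  by have [/hD[]] := hr _ (zr tau).
have hv tau : has_velocity e tau (v tau).
  exact: (has_velocity_comp (holomorphic_at_differentiable (hphi tau)) (hzt tau)).
have ts : t - s != 0 by rewrite subr_eq0 gt_eqF.
have C1e : C1_curve e.
  apply: (C1_curveI hv) => tau.
  apply: (diff_cvg (hphi tau) (has_velocity_continuous (hzt tau))).
  apply/cvg_enormP => e1 e10.
  have w1 : 0 < 1 + enorm w by rewrite ltr_pwDl ?enorm_ge0.
  have /cvgrPdist_lt/(_ _ (divr_gt0 e10 w1)) := @dease_in_continuous R s t tau.
  apply: filterS => a; rewrite ltr_pdivlMr// distrC => ha.
  have -> : (dease_in s t a)%:C *: w - (dease_in s t tau)%:C *: w =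
      (dease_in s t a - dease_in s t tau)%:C *: w by rewrite rmorphB scalerBl.
  by rewrite enormZR (le_lt_trans _ ha)// ler_wpM2l// lerDr.
exists e; split.
- exact: C1e.
- split.
    by rewrite /e /= /zt /ease_in subrr mul0r ease0 scale0r addr0.
  by rewrite /e /= /zt /ease_in divff// ease1 scale1r /w [z0 + _]addrC subrK.
- by move=> tau; have [/phiX ? ? _ _] := hr _ (zr tau).
- move=> k F hF FG.
  rewrite -[leRHS](integral_dease_in _ st).
  apply: ge0_le_integral => //.
  + by move=> tau _; rewrite lee_fin enorm_ge0.
  + exact: (speed_measurable (pwC1_one st C1e (fun _ _ => erefl)) (fun tau _ => hF tau)).
  + apply/measurable_EFinP; apply: measurable_funTS.
    apply: continuous_measurable_fun => tau; apply: cvgMr.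
    exact: dease_in_continuous.
  + move=> tau /=; rewrite in_itv/= => /andP[/ltW stau /ltW taut].
    rewrite lee_fin /pullback_norm (has_velocity_velocity (hv tau)) /v !linearZ enormZR.
    rewrite ger0_norm ?dease_in_ge0 ?stau// mulrC ler_wpM2r//.
      by rewrite dease_in_ge0 ?stau.
    by rewrite (le_trans (FG _ _))//; exact: key.
Unshelve. all: by end_near. Qed.

End ChartLemma.

(** * Lifting a path to a piecewise C^1 path *)

Section Approximation.
Local Open Scope complex_scope.
Context {R : realType}.
Notation mu := (@lebesgue_measure R).

Variables (N k m : nat) (X W : set 'rV[R[i]]_N).
Variables (F : 'rV[R[i]]_N -> 'rV[R[i]]_k) (G : 'rV[R[i]]_N -> 'rV[R[i]]_m).
Variables (c0 : R -> 'rV[R[i]]_N) (eps : R).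
Hypothesis oW : open W.
Hypothesis hF : forall p, W p -> holomorphic_at F p.
Hypothesis hG : forall p, W p -> holomorphic_at G p.
Hypothesis FG : forall p u, W p -> enorm ('d F p u) <= enorm ('d G p u).
Hypothesis Xreg : forall p, X p -> W p -> p != 0 -> regular_at X p.
Hypothesis Gimm : forall p, X p -> W p -> p != 0 ->
  forall u, tangent_space X p u -> 'd G p u = 0 -> u = 0.
Hypothesis c0c : {within `[0, 1], continuous c0}.
Hypothesis c0X : forall t : R, 0 <= t <= 1 -> X (c0 t) /\ W (c0 t).
Hypothesis eps0 : 0 < eps.

Let speed c t := (pullback_norm F (c t) (velocity c t))%:E.

(** A curve with the same ends as [c0], whose length is controlled by a polygonal
    line inscribed in [G \o c0]. The bound by [2 * enorm (c0 x)] makes it tend to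
    the origin wherever [c0] does. *)
Definition close_curve (c : R -> 'rV[R[i]]_N) (s t : R) : Prop :=
  [/\ pwC1 c s t,
      forall x, s <= x <= t ->
        [/\ X (c x), W (c x), c x != 0 & enorm (c x) <= 2 * enorm (c0 x)],
      c s = c0 s /\ c t = c0 t
    & exists2 sg, itv_partition s t sg &
        (\int[mu]_(x in `]s, t[) speed c x <=
          ((1 + eps) * vsum (chord (G \o c0)%FUN) s sg)%:E)%E].

Lemma close_curve_ext c d (s t : R) :
  (forall x, s <= x <= t -> c x = d x) -> close_curve c s t -> close_curve d s t.
Proof.
move=> cd [pw hc [cs ct] [sg hsg le]]; have /ltW st := pwC1_lt pw; split.
- exact: pwC1_ext pw.
- by move=> x xst; rewrite -cd//; exact: hc.
- by rewrite -!cd ?lexx ?st.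
- exists sg; first exact: hsg.
  apply: le_trans le.
  rewrite le_eqVlt; apply/orP; left; apply/eqP; apply: eq_integral => x.
  rewrite inE/= in_itv/= => xst; congr EFin.
  have h := @pwC1_one_velocity _ _ d c s t x (fun y yst => esym (cd y yst)) xst.
  by rewrite (near_eq_velocity h) (nbhs_singleton h).
Qed.

Lemma close_curve_measurable c (s t : R) :
  close_curve c s t -> measurable_fun `]s, t[ (speed c).
Proof.
move=> [pw hc _ _]; apply: (speed_measurable pw) => x /hc[_ Wx _ _]; exact: hF.
Qed.

Lemma speed_ge0 c x : (0 <= speed c x)%E.
Proof. by rewrite lee_fin enorm_ge0. Qed.

Lemma close_curve_cat c (s t u : R) :
  close_curve c s t -> close_curve c t u -> close_curve c s u.
Proof.
move=> h1 h2; have m1 := close_curve_measurable h1; have m2 := close_curve_measurable h2.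
move: h1 h2 => [pw1 hc1 [cs ct] [sg1 p1 le1]] [pw2 hc2 [_ cu] [sg2 p2 le2]].
have st := pwC1_lt pw1; have tu := pwC1_lt pw2; split.
- exact: pwC1_cat pw1 pw2.
- move=> x /andP[sx xu]; have [xt|/ltW tx] := leP x t.
    by apply: hc1; rewrite sx.
  by apply: hc2; rewrite tx.
- by [].
- exists (sg1 ++ sg2); first exact: itv_partition_cat p1 p2.
  rewrite (integral_oo_cat st tu m1 m2 (speed_ge0 c)) vsum_cat mulrDr EFinD.
  by case: p1 => _ /eqP ->; exact: leeD.
Qed.

Definition glue (t : R) (c d : R -> 'rV[R[i]]_N) : R -> 'rV[R[i]]_N :=
  fun x => if x <= t then c x else d x.

Lemma close_curve_glue c d (s t u : R) :
  close_curve c s t -> close_curve d t u -> close_curve (glue t c d) s u.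
Proof.
move=> h1 h2; have [_ _ [_ ct] _] := h1; have [_ _ [dt _] _] := h2.
apply: (@close_curve_cat _ _ t).
  by apply: close_curve_ext h1 => x /andP[_ xt]; rewrite /glue xt.
apply: close_curve_ext h2 => x /andP[tx _]; rewrite /glue; case: ifPn => // xt.
by have -> : x = t by [apply/le_anti; rewrite xt]; rewrite ct dt.
Qed.

(** A segment in a chart around [p = c0 x]. The chart is taken in the ball of radius
    [enorm p / 4] around [p], where norms lie between 3/4 and 5/4 of that of [p],
    so that the segment avoids the origin and is at most twice as far from it as
    [c0]. *)
Lemma close_curve_local (x : R) : 0 <= x <= 1 -> c0 x != 0 ->
  exists2 d : R, 0 < d & forall s t : R, 0 <= s -> s <= x -> x <= t -> t <= 1 -> s < t ->
    x - d < s -> t < x + d -> exists c, close_curve c s t.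
Proof.
move=> x01 p0; set p := c0 x in p0 *; have [Xp Wp] := c0X x01.
have e0 : 0 < enorm p / 4 by rewrite divr_gt0// enorm_gt0.
pose U := W `&` [set y | enorm (y - p) < enorm p / 4].
have pU : nbhs p U.
  apply: filterI; first exact: open_nbhs_nbhs.
  by apply/nbhs_enormP; exists (enorm p / 4).
have [V pV hV] := chart_segments (Xreg Xp Wp p0) (hG Wp) (Gimm Xp Wp p0) pU eps0.
move: pV => /nbhs_enormP[r r0 rV].
have r'0 : 0 < Num.min r (enorm p / 4) by rewrite lt_min r0.
move/within_continuous_enormP : c0c => /(_ x).
rewrite /= in_itv/= => /(_ x01 _ r'0)/nbhs_ballP[d /= d0 hd].
have near y : 0 <= y <= 1 -> x - d < y < x + d ->
    V (c0 y) /\ enorm (c0 y - p) < enorm p / 4.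
  move=> y01 yd; have : enorm (c0 y - c0 x) < Num.min r (enorm p / 4).
    apply: hd; last by rewrite /= in_itv.
    by rewrite /ball/= ltr_norml; case/andP: yd => *; apply/andP; split; lra.
  by rewrite lt_min => /andP[/rV].
exists d => // s t s0 sx xt t1 st ds td.
have itv01 y : s <= y <= t -> 0 <= y <= 1.
  by move=> /andP[sy yt]; rewrite (le_trans s0 sy) (le_trans yt t1).
have itvd y : s <= y <= t -> x - d < y < x + d.
  by move=> /andP[sy yt]; rewrite (lt_le_trans ds sy) (le_lt_trans yt td).
have sst : s <= s <= t by rewrite lexx ltW.
have tst : s <= t <= t by rewrite lexx ltW.
have [Vs _] := near s (itv01 s sst) (itvd s sst).
have [Vt _] := near t (itv01 t tst) (itvd t tst).
have [e [he [es et] eXU le]] :=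
  hV _ _ s t (c0X (itv01 s sst)).1 Vs (c0X (itv01 t tst)).1 Vt st.
exists e; split.
- exact: (pwC1_one st he (fun _ _ => erefl)).
- move=> y yst; have [Xe [We /= ep]] := eXU y.
  have [_ h] := near y (itv01 y yst) (itvd y yst).
  have := ler_enorm_sub p (c0 y); have := ler_enorm_sub p (e y).
  have := ler_enorm_sub (e y) p.
  rewrite (enormBC p (e y)) (enormBC p (c0 y)) => h1 h2 h3; split => //.
    apply/eqP => ey; move: h2; rewrite ey enorm0; move: e0 ep; rewrite ey; lra.
  move: e0 ep h h1 h2 h3; lra.
- by [].
- exists [:: t]; first exact: itv_partition1.
  rewrite /= addr0; apply: le.
    by move=> tau; apply: hF; have [_ []] := eXU tau.
  by move=> tau v; apply: FG; have [_ []] := eXU tau.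
Qed.

Lemma close_curve_exists (s t : R) : 0 <= s -> s < t -> t <= 1 ->
  (forall x, s <= x <= t -> c0 x != 0) -> exists c, close_curve c s t.
Proof.
move=> s0 st t1 nz.
apply: (@cousin _ (fun s t => exists c, close_curve c s t) s t st).
  by move=> x y z _ _ _ _ [c1 h1] [c2 h2]; exists (glue y c1 c2); exact: close_curve_glue.
move=> x xst; have x01 : 0 <= x <= 1.
  by case/andP: xst => sx xt; rewrite (le_trans s0 sx) (le_trans xt t1).
have [d d0 hd] := close_curve_local x01 (nz x xst).
exists d => // a b sa ax xb bt ab da db; apply: hd => //; [exact: le_trans sa|exact: le_trans t1].
Qed.

Lemma close_curve_extr c (s t u : R) : close_curve c s t -> 0 <= t -> t <= u -> u <= 1 ->
  (forall x, t <= x <= u -> c0 x != 0) ->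
  exists2 d, close_curve d s u & forall x, s <= x <= t -> d x = c x.
Proof.
move=> hc t0; rewrite le_eqVlt => /predU1P[<- _ _|tu u1 nz]; first by exists c.
have [c' hc'] := close_curve_exists t0 tu u1 nz.
exists (glue t c c'); first exact: close_curve_glue.
by move=> x /andP[_ xt]; rewrite /glue xt.
Qed.

Lemma close_curve_extl c (s t u : R) : close_curve c t u -> 0 <= s -> s <= t -> t <= 1 ->
  (forall x, s <= x <= t -> c0 x != 0) ->
  exists2 d, close_curve d s u & forall x, t <= x <= u -> d x = c x.
Proof.
move=> hc s0; rewrite le_eqVlt => /predU1P[-> _ _|st t1 nz]; first by exists c.
have [c' hc'] := close_curve_exists s0 st t1 nz.
exists (glue t c' c); first exact: close_curve_glue.
move=> x /andP[tx _]; rewrite /glue; case: ifPn => // xt.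
have -> : x = t by apply/le_anti; rewrite xt.
by have [_ _ [_ ->] _] := hc'; have [_ _ [-> _] _] := hc.
Qed.

(** The curves on the successive intervals are chosen one after the other, each
    extending the previous one; their common extension takes at [x] the value of
    any of them that is defined at [x]. *)
Lemma close_curve_exhaustion (s_ t_ : nat -> R) :
  (forall n, [/\ 0 <= s_ n.+1, s_ n.+1 <= s_ n, s_ n < t_ n, t_ n <= t_ n.+1 & t_ n.+1 <= 1]) ->
  (forall n x, s_ n <= x <= t_ n -> c0 x != 0) ->
  exists c, forall n, close_curve c (s_ n) (t_ n).
Proof.
move=> st nz.
have s0 n : 0 <= s_ n by have [h1 h2 _ _ _] := st n; exact: le_trans h2.
have t1 n : t_ n <= 1 by have [_ _ _ h1 h2] := st n; exact: le_trans h2.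
have step (nc : nat * (R -> 'rV[R[i]]_N)) : exists d,
    close_curve nc.2 (s_ nc.1) (t_ nc.1) ->
    close_curve d (s_ nc.1.+1) (t_ nc.1.+1) /\
    forall x, s_ nc.1 <= x <= t_ nc.1 -> d x = nc.2 x.
  case: nc => n c /=; have [hc|] := pselect (close_curve c (s_ n) (t_ n)); last by exists c.
  have [h1 h2 h3 h4 h5] := st n.
  have [||||d1 hd1 E1] := @close_curve_extr c (s_ n) (t_ n) (t_ n.+1) hc.
  - exact: le_trans (s0 n) (ltW h3).
  - by [].
  - by [].
  - by move=> x /andP[tx xt]; apply: (nz n.+1); rewrite xt andbT (le_trans h2 (le_trans (ltW h3) tx)).
  have [||||d2 hd2 E2] := @close_curve_extl d1 (s_ n.+1) (s_ n) (t_ n.+1) hd1.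
  - by [].
  - by [].
  - exact: le_trans (ltW h3) (t1 n).
  - by move=> x /andP[sx xs]; apply: (nz n.+1); rewrite sx (le_trans xs (le_trans (ltW h3) h4)).
  exists d2 => _; split => // x /andP[sx xt].
  by rewrite E2 ?E1 ?sx//= (le_trans xt).
have [next hnext] := choice step.
have [c00 hc00] : exists c, close_curve c (s_ 0%N) (t_ 0%N).
  by have [_ _ ? _ _] := st 0%N; apply: close_curve_exists => //; exact: nz.
pose E := fix E n := if n is n'.+1 then next (n', E n') else c00.
have hE n : close_curve (E n) (s_ n) (t_ n).
  by elim: n => [//|n ih]; have [] := hnext (n, E n) ih.
have EE n j x : s_ n <= x <= t_ n -> E (n + j)%N x = E n x.
  move=> xn; have mono i : s_ (n + i)%N <= x <= t_ (n + i)%N.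
    elim: i => [|i /andP[ih1 ih2]]; first by rewrite addn0.
    rewrite addnS; have [_ h2 _ h4 _] := st (n + i)%N.
    by rewrite (le_trans h2 ih1) (le_trans ih2 h4).
  elim: j => [|j ih]; first by rewrite addn0.
  have [_ h] := hnext ((n + j)%N, E (n + j)%N) (hE _).
  by rewrite addnS -ih; exact: h x (mono j).
pose idx x := xget 0%N [set n | s_ n <= x <= t_ n].
exists (fun x => E (idx x) x) => n.
apply: close_curve_ext (hE n) => x xn.
have : [set n | s_ n <= x <= t_ n] (idx x) by apply: (xgetI 0%N (x := n)).
move=> /= xi; have [ni|/ltnW ni] := leqP n (idx x).
  by rewrite -(subnKC ni) EE.
by rewrite -(subnKC ni) EE.
Qed.

Definition short_path (c : R -> 'rV[R[i]]_N) : Prop :=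
  [/\ path_in (X `&` W) (c0 0) (c0 1) c,
      forall a b : R, 0 <= a -> a < b -> b <= 1 ->
        (forall t, `[a, b]%classic t -> c t != 0) -> piecewise_C1 a b c
    & (metric_length F c <= (1 + eps)%:E * arc_length (G \o c0)%FUN)%E].

Lemma short_path_nonzero : (forall x, 0 <= x <= 1 -> c0 x != 0) ->
  exists c, short_path c.
Proof.
move=> nz; have [c hc] := close_curve_exists (lexx 0) ltr01 (lexx 1) nz.
have mc := close_curve_measurable hc.
have [pw cX [c00 c01] [sg psg le]] := hc.
exists c; split.
- split; [exact: pwC1_continuous pw|exact: c00|exact: c01|].
  by move=> t; rewrite /= in_itv/= => /cX[].
- move=> a b a0 ab b1 _; apply: pwC1_piecewise_C1.
  exact: (pwC1_sub pw a0 ab b1).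
- rewrite /metric_length (_ : _ `&` _ = `[0, 1]%classic); last first.
    apply/seteqP; split => [t []//|t t01]; split => //.
    by move: t01; rewrite /= in_itv/= => /cX[].
  rewrite integral_itv_bndoo//; apply: (le_trans le).
  rewrite EFinM lee_wpmul2l//; first by rewrite lee_fin addr_ge0// ltW.
  exact: vsum_le_arc_length.
Qed.

(** The premise [0 < a] of the conclusion leaves nothing to find if [c0] starts at
    the origin. *)
Lemma left_curve (a : R) : 0 <= a -> a <= 1 -> (forall x, 0 <= x -> x < a -> c0 x != 0) ->
  exists c, forall n : nat, 0 < a -> close_curve c 0 (a - a / n.+2%:R).
Proof.
rewrite le_eqVlt => /predU1P[<- _ _|a0 a1 nz]; first by exists c0 => n; rewrite ltxx.
have lt_a n : a - a / n.+2%:R < a by rewrite ltrBlDr ltrDl divr_gt0.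
have [|n x /andP[x0 xa]|c hc] :=
    @close_curve_exhaustion (fun=> 0) (fun n => a - a / n.+2%:R).
- move=> n; split => //.
  + by rewrite subr_gt0 ltr_pdivrMr// ltr_pMr// ltr1n.
  + by rewrite lerB// ler_pM2l// lef_pV2 ?posrE// ler_nat.
  + exact: le_trans (ltW (lt_a _)) a1.
- by apply: nz => //; exact: le_lt_trans (lt_a n).
- by exists c => n _; exact: hc.
Qed.

Lemma right_curve (b : R) : 0 <= b -> b <= 1 -> (forall x, b < x -> x <= 1 -> c0 x != 0) ->
  exists c, forall n : nat, b < 1 -> close_curve c (b + (1 - b) / n.+2%:R) 1.
Proof.
move=> b0; rewrite le_eqVlt => /predU1P[-> _|b1 nz]; first by exists c0 => n; rewrite ltxx.
have b1' : 0 < 1 - b by rewrite subr_gt0.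
have lt_b n : b < b + (1 - b) / n.+2%:R by rewrite ltrDl divr_gt0.
have [|n x /andP[xb x1]|c hc] :=
    @close_curve_exhaustion (fun n => b + (1 - b) / n.+2%:R) (fun=> 1).
- move=> n; split => //.
  + exact: le_trans b0 (ltW (lt_b _)).
  + by rewrite lerD2l ler_pM2l// lef_pV2 ?posrE// ler_nat.
  + by rewrite -ltrBrDl ltr_pdivrMr// ltr_pMr// ltr1n.
- by apply: nz => //; exact: lt_le_trans (lt_b n) xb.
- by exists c => n _; exact: hc.
Qed.

Lemma small_quotient (u v : R) : 0 <= u -> 0 < v -> exists n : nat, u / n.+2%:R < v.
Proof.
move=> u0 v0; exists (Num.bound (u / v)).
have := archi_boundP (divr_ge0 u0 (ltW v0)).
rewrite ltr_pdivrMr// => h; rewrite ltr_pdivrMr// mulrC (lt_le_trans h)//.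
by rewrite ler_pM2r// ler_nat ltnW.
Qed.

(** Before the first zero [a] of [c0] and after the last one [b], the path follows
    [c0] closely; in between it waits at the origin, at no cost. It has infinitely
    many pieces near [a] and [b], so its length is obtained by monotone
    convergence. *)
Lemma short_path_zero (a b : R) : 0 <= a -> a <= b -> b <= 1 -> c0 a = 0 -> c0 b = 0 ->
  (forall x, 0 <= x -> x < a -> c0 x != 0) ->
  (forall x, b < x -> x <= 1 -> c0 x != 0) ->
  exists c, short_path c.
Proof.
move=> a0 ab b1 ca cb nza nzb.
have [c1 hc1] := left_curve a0 (le_trans ab b1) nza.
have [c2 hc2] := right_curve (le_trans a0 ab) b1 nzb.
pose t_ (n : nat) := a - a / n.+2%:R; pose s_ (n : nat) := b + (1 - b) / n.+2%:R.
pose c x := if x < a then c1 x else if x <= b then 0 else c2 x.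
have tlt n : 0 < a -> t_ n < a by move=> ?; rewrite ltrBlDr ltrDl divr_gt0.
have slt n : b < 1 -> b < s_ n by move=> ?; rewrite ltrDl divr_gt0// subr_gt0.
have tle n : t_ n <= a by rewrite lerBlDr lerDl divr_ge0.
have sle n : b <= s_ n by rewrite lerDl divr_ge0// subr_ge0.
have hl n : 0 < a -> close_curve c 0 (t_ n).
  move=> ap; apply: close_curve_ext (hc1 n ap) => x /andP[_ xt].
  by rewrite /c (le_lt_trans xt (tlt n ap)).
have hr n : b < 1 -> close_curve c (s_ n) 1.
  move=> bp; apply: close_curve_ext (hc2 n bp) => x /andP[sx _].
  have bx := lt_le_trans (slt n bp) sx.
  by rewrite /c ltNge (le_trans ab (ltW bx))/= leNgt bx.
have tx x : x < a -> exists n, x < t_ n.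
  rewrite -subr_gt0 => xa; have [n hn] := small_quotient a0 xa.
  by exists n; rewrite /t_ ltrBrDr -ltrBrDl.
have sx x : b < x -> exists n, s_ n < x.
  rewrite -subr_gt0 => bx; have b1' : 0 <= 1 - b by rewrite subr_ge0.
  have [n hn] := small_quotient b1' bx.
  by exists n; rewrite /s_ -ltrBrDl.
have cP x : 0 <= x <= 1 -> a <= x <= b \/
    [/\ X (c x), W (c x), c x != 0 & enorm (c x) <= 2 * enorm (c0 x)].
  move=> /andP[x0 x1]; have [xa|ax] := ltP x a.
    right; have [n xt] := tx x xa.
    have [_ h _ _] := hl n (le_lt_trans x0 xa).
    by apply: h; rewrite x0 ltW.
  have [xb|bx] := leP x b; [by left|right].
  have [n xs] := sx x bx.
  have [_ h _ _] := hr n (lt_le_trans bx x1).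
  by apply: h; rewrite x1 ltW.
have cab x : a <= x <= b -> c x = 0.
  by move=> /andP[ax xb]; rewrite /c ltNge ax /= xb.
have ab01 : 0 <= a <= 1 by rewrite a0 (le_trans ab).
have cc : {within `[0, 1], continuous c}.
  apply/within_continuous_enormP => x; rewrite /= in_itv/= => x01 e e0.
  have [xa|ax] := ltP x a.
    have [n xt] := tx x xa.
    have ap : 0 < a by case/andP: x01 => x0 _; exact: le_lt_trans xa.
    have [pw _ _ _] := hl n ap.
    have /within_continuous_enormP/(_ x) := pwC1_continuous pw.
    rewrite /= in_itv/=; case/andP: x01 => x0 _; rewrite x0 (ltW xt) => /(_ isT _ e0) h.
    near=> y; rewrite /= in_itv/= => /andP[y0 _].
    have : `[0, t_ n]%classic y -> enorm (c y - c x) < e by near: y; exact: h.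
    apply; rewrite /= in_itv/= y0/= ltW//.
    by near: y; exact: lt_nbhsl.
  have [xb|bx] := leP x b; last first.
    have [n sx'] := sx x bx.
    have bp : b < 1 by case/andP: x01 => _ x1; exact: lt_le_trans x1.
    have [pw _ _ _] := hr n bp.
    have /within_continuous_enormP/(_ x) := pwC1_continuous pw.
    rewrite /= in_itv/=; case/andP: x01 => _ x1; rewrite x1 (ltW sx') => /(_ isT _ e0) h.
    near=> y; rewrite /= in_itv/= => /andP[_ y1].
    have : `[s_ n, 1]%classic y -> enorm (c y - c x) < e by near: y; exact: h.
    apply; rewrite /= in_itv/= y1 andbT ltW//.
    by near: y; exact: lt_nbhsr.
  have cx0 : c x = 0 by apply: cab; rewrite ax.
  rewrite cx0.
  (* A zero of c0, such as a and b, is dealt with by the bound on the norm of c;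
     any other point of [a, b] is interior, and c is zero around it. *)
  have [c0x|c0x] := eqVneq (c0 x) 0.
    move/within_continuous_enormP : c0c => /(_ x).
    rewrite /= in_itv/= => /(_ x01 (e / 2)); rewrite divr_gt0// => /(_ isT).
    apply: filterS => y h; rewrite /= in_itv/= => y01; rewrite subr0.
    have {h} := h y01; rewrite c0x subr0 => h.
    have [/cab ->|[_ _ _ h']] := cP y y01; first by rewrite enorm0.
    by rewrite (le_lt_trans h')// mulrC -ltr_pdivlMr.
  have {}ax : a < x by rewrite lt_neqAle ax andbT; apply: contra c0x => /eqP <-; rewrite ca.
  have {}xb : x < b by rewrite lt_neqAle xb andbT; apply: contra c0x => /eqP ->; rewrite cb.
  near=> y => _; rewrite cab ?subrr ?subr0 ?enorm0//; apply/andP; split; apply: ltW.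
    by near: y; exact: lt_nbhsr.
  by near: y; exact: lt_nbhsl.
exists c; split.
- split; first exact: cc.
  + move: a0; rewrite le_eqVlt => /predU1P[a0|ap].
      by rewrite cab ?a0 ?lexx// -{1}ca -a0.
    by have [_ _ [-> _] _] := hl 0%N ap.
  + move: b1; rewrite le_eqVlt => /predU1P[b1|bp].
      by rewrite cab -b1 ?lexx ?ab ?cb.
    by have [_ _ [_ ->] _] := hr 0%N bp.
  + move=> x; rewrite /= in_itv/= => /cP[/cab ->|[? ? _ _]]; last by [].
    by rewrite -ca; exact: c0X.
- move=> x y x0 xy y1 nz; apply: pwC1_piecewise_C1.
  have [ya|ay] := ltP y a.
    have [n yt] := tx y ya.
    have ap : 0 < a by apply: le_lt_trans x0 (lt_trans xy ya).
    have [pw _ _ _] := hl n ap.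
    by apply: (pwC1_sub pw) => //; exact: ltW.
  have [bx|xb] := ltP b x.
    have [n xs] := sx x bx.
    have bp : b < 1 by apply: lt_trans bx (lt_le_trans xy y1).
    have [pw _ _ _] := hr n bp.
    by apply: (pwC1_sub pw) => //; exact: ltW.
  have : c (Num.max x a) != 0.
    by apply: nz; rewrite /= in_itv/= le_max lexx/= ge_max (ltW xy) ay.
  by rewrite cab ?eqxx// le_max lexx orbT/= ge_max xb ab.
- pose D n := `[0, t_ n[%classic `|` `]s_ n, 1]%classic.
  have DE : `[0, 1]%classic `&` [set s | c s != 0] = \bigcup_n D n.
    apply/seteqP; split => [x [/= + cx]|x [n _ [/=|/=]]]; rewrite ?in_itv/=.
    - move=> /andP[x0 x1]; have [xa|ax] := ltP x a.
        by have [n xt] := tx x xa; exists n => //; left; rewrite /= in_itv/= x0.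
      have [xb|bx] := leP x b; first by move: cx; rewrite cab ?eqxx ?ax.
      by have [n xs] := sx x bx; exists n => //; right; rewrite /= in_itv/= x1 xs.
    - move=> /andP[x0 xt]; have xa := lt_le_trans xt (tle n).
      have x1 : x <= 1 by rewrite (le_trans (ltW xa))// (le_trans ab).
      split; first by rewrite /= ?in_itv/= x0.
      have [_ h _ _] := hl n (le_lt_trans x0 xa).
      by have [|_ _ ? _] := h x; first by rewrite x0 ltW.
    - move=> /andP[xs x1]; have bx := le_lt_trans (sle n) xs.
      have x0 : 0 <= x by rewrite (le_trans a0)// (le_trans ab)// ltW.
      split; first by rewrite /= ?in_itv/= x0.
      have [_ h _ _] := hr n (lt_le_trans bx x1).
      by have [|_ _ ? _] := h x; first by rewrite x1 ltW.
  have left n : measurable_fun `]0, t_ n[ (speed c) /\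
      exists2 sg, itv_partition 0 (t_ n) sg & (\int[mu]_(x in `]0%R, t_ n[) speed c x <=
          ((1 + eps) * vsum (chord (G \o c0)%FUN) 0 sg)%:E)%E.
    move: (a0); rewrite le_eqVlt => /predU1P[a00|ap].
      have -> : t_ n = 0 by rewrite /t_ -a00 mul0r subrr.
      rewrite set_itvoo0; split; first exact: measurable_fun_set0.
      by exists [::]; rewrite ?integral_set0 //= mulr0.
    split; first exact: close_curve_measurable (hl n ap).
    by have [_ _ _ ?] := hl n ap.
  have right n : measurable_fun `]s_ n, 1[ (speed c) /\
      exists2 sg, itv_partition (s_ n) 1 sg & (\int[mu]_(x in `]s_ n, 1%R[) speed c x <=
          ((1 + eps) * vsum (chord (G \o c0)%FUN) (s_ n) sg)%:E)%E.
    move: (b1); rewrite le_eqVlt => /predU1P[b11|bp].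
      have -> : s_ n = 1 by rewrite /s_ b11 subrr mul0r addr0.
      rewrite set_itvoo0; split; first exact: measurable_fun_set0.
      by exists [::]; rewrite ?integral_set0 //= mulr0.
    split; first exact: close_curve_measurable (hr n bp).
    by have [_ _ _ ?] := hr n bp.
  have ts n : t_ n < s_ n.
    move: (b1); rewrite le_eqVlt => /predU1P[b11|bp]; last first.
      exact: le_lt_trans (le_trans (tle n) ab) (slt n bp).
    move: (a0); rewrite le_eqVlt => /predU1P[a00|ap]; last first.
      exact: lt_le_trans (tlt n ap) (le_trans ab (sle n)).
    by rewrite /t_ /s_ -a00 b11 subrr !mul0r subr0 addr0.
  have mD n : measurable_fun (D n) (speed c).
    apply/measurable_funU => //; split.
    - have [h _] := left n.
      apply: (measurable_funS _ (_ : _ `<=` [set 0] `|` `]0, t_ n[%classic)).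
      + exact: measurableU.
      + move=> x /=; rewrite !in_itv/= le_eqVlt => /andP[/predU1P[<- _|x0 xt]].
          by left.
        by right; rewrite x0.
      + by apply/measurable_funU => //; split => //; exact: measurable_fun_set1.
    - have [h _] := right n.
      apply: (measurable_funS _ (_ : _ `<=` [set 1] `|` `]s_ n, 1[%classic)).
      + exact: measurableU.
      + move=> x /=; rewrite !in_itv/= le_eqVlt => /andP[xs /predU1P[->|x1]].
          by left.
        by right; rewrite xs.
      + by apply/measurable_funU => //; split => //; exact: measurable_fun_set1.
  have bound n : (\int[mu]_(x in D n) speed c x <= (1 + eps)%:E * arc_length (G \o c0)%FUN)%E.
    have [m1 [sg1 p1 l1]] := left n; have [m2 [sg2 p2 l2]] := right n.
    rewrite ge0_integral_setU//; last 3 first.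
    - exact: mD.
    - by move=> x _; exact: speed_ge0.
    - apply/disj_setPS => x [/=]; rewrite !in_itv/= => /andP[_ xt] /andP[sx' _].
      by move: (lt_trans sx' xt); rewrite ltNge (ltW (ts n)).
    rewrite !integral_itv_bndoo//.
    apply: (le_trans (leeD l1 l2)); rewrite -EFinD -mulrDr EFinM.
    apply: lee_wpmul2l; first by rewrite lee_fin addr_ge0// ltW.
    exact: vsum2_le_arc_length (ts n) p1 p2.
  rewrite /metric_length DE.
  have ndD : nondecreasing_seq D.
    apply/nondecreasing_seqP => n; rewrite subsetEset.
    have tn : t_ n <= t_ n.+1.
      by rewrite lerB// ler_wpM2l// lef_pV2 ?posrE// ler_nat.
    have sn : s_ n.+1 <= s_ n.
      by rewrite lerD2l ler_wpM2l ?subr_ge0// lef_pV2 ?posrE// ler_nat.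
    move=> x [/=|/=]; rewrite in_itv/= => /andP[h1 h2]; [left|right].
      by rewrite /= in_itv/= h1 (lt_le_trans h2).
    by rewrite /= in_itv/= h2 (le_lt_trans sn).
  have mDn n : measurable (D n) by exact: measurableU.
  have cvgD := ge0_nondecreasing_set_cvg_integral (mu := mu) ndD mDn mD
    (fun n x _ => speed_ge0 c x).
  rewrite -(cvg_lim _ cvgD)//.
  apply: lime_le; first by apply/cvg_ex; eexists; exact: cvgD.
  by apply: nearW => n; exact: bound.
Unshelve. all: by end_near. Qed.

Lemma exists_short_path : exists c, short_path c.
Proof.
have [Z|NZ] := pselect (exists2 x, 0 <= x <= 1 & c0 x = 0).
  have [a [/andP[a0 a1] ca nza]] := first_zero c0c Z.
  have [b [/andP[b0 b1] cb nzb]] := last_zero c0c Z.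
  apply: (short_path_zero a0 _ b1 ca cb nza nzb).
  by rewrite leNgt; apply/negP => ba; have := nzb a ba a1; rewrite ca eqxx.
by apply: short_path_nonzero => x x01; apply/eqP => cx; apply: NZ; exists x.
Qed.

End Approximation.

(** * Comparison of the two metrics *)

Section Comparison.
Local Open Scope complex_scope.
Context {R : realType}.

Lemma diff_coord n k (F : 'rV[R[i]]_n -> 'rV[R[i]]_k) j p u :
  differentiable F p -> 'd (Defs.coord F j) p u = ('d F p u) 0 j.
Proof.
move=> dF; have lin : linear (fun v : 'rV[R[i]]_k => v 0 j : R[i]).
  by move=> a x y; rewrite !mxE.
pose linM := GRing.isLinear.Build _ _ _ _ _ lin.
pose L : {linear 'rV[R[i]]_k -> R[i]} := HB.pack (fun v : 'rV[R[i]]_k => v 0 j : R[i]) linM.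
have cL : continuous L by exact: coord_continuous.
have dL : differentiable L (F p) by exact: linear_differentiable.
by have := diff_comp dF dL; rewrite (diff_lin _ cL) => /(congr1 (fun f => f u)).
Qed.

(** The coordinates of [F] are among those of [pair_map F g]. *)
Lemma enorm_diff_pair n k r (F : 'rV[R[i]]_n -> 'rV[R[i]]_k)
    (g : 'rV[R[i]]_n -> 'rV[R[i]]_r) p u :
  differentiable F p -> differentiable (pair_map F g) p ->
  enorm ('d F p u) <= enorm ('d (pair_map F g) p u).
Proof.
move=> dF dG; rewrite /enorm ler_sqrt; last first.
  by apply: sumr_ge0 => j _; rewrite addr_ge0 ?sqr_ge0.
rewrite [leRHS]big_split_ord /= ler_wpDr//.
  by apply: sumr_ge0 => j _; rewrite addr_ge0 ?sqr_ge0.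
apply: ler_sum => j _.
have cE : Defs.coord (pair_map F g) (lshift r j) = Defs.coord F j.
  by apply/funext => x; rewrite /Defs.coord /pair_map row_mxEl.
by rewrite -(diff_coord (lshift r j) u dG) -(diff_coord j u dF) cE.
Qed.

Lemma enorm_le_combination k m (lam : 'I_m -> 'I_k -> R[i]) (M : R)
    (v : 'rV[R[i]]_k) (w : 'rV[R[i]]_m) :
  (forall j i, normc (lam j i) <= M) ->
  (forall j, w 0 j = \sum_i lam j i * v 0 i) ->
  enorm w <= (\sum_(j < m) \sum_(i < k) M) * enorm v.
Proof.
move=> hM hw; apply: (le_trans (enorm_le_sum _)); rewrite mulr_suml.
apply: ler_sum => j _; rewrite hw mulr_suml.
elim/big_ind2 : _ => [|x a y b ha hb|i _]; first by rewrite normc0.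
  by rewrite (le_trans (le_normcD _ _))// lerD.
by rewrite normcM; apply: ler_pM; rewrite ?normc_ge0 ?normc_le_enorm.
Qed.

Lemma holomorphic_at_bounded n (f : 'rV[R[i]]_n -> R[i]) x :
  holomorphic_at f x -> \forall y \near x, normc (f y) <= normc (f x) + 1.
Proof.
move=> /holomorphic_at_continuous cf.
have : nbhs (f x) [set z | normc (z - f x) < 1] by apply/nbhs_normcP; exists 1.
move=> /(near_continuous cf); apply: filterS => y /= h.
by rewrite -{1}(subrK (f x) (f y)) (le_trans (le_normcD _ _))// addrC lerD2l ltW.
Qed.

Lemma vsum_chord_ext n (c d : R -> 'rV[R[i]]_n) b s (a : R) :
  (forall x, a <= x <= b -> c x = d x) -> itv_partition a b s ->
  vsum (chord c) a s = vsum (chord d) a s.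
Proof.
elim: s a => //= x s ih a cd hs.
have ax : a < x by case: hs => /= /andP[].
have hs' := itv_partition_cons hs; have xb := itv_partition_le hs'.
rewrite ih//; last by move=> y /andP[xy yb]; apply: cd; rewrite yb (le_trans (ltW ax)).
by rewrite /chord !cd ?lexx ?(ltW ax) ?xb ?(le_trans (ltW ax)).
Qed.

Lemma arc_length_ext n (c d : R -> 'rV[R[i]]_n) :
  (forall x, 0 <= x <= 1 -> c x = d x) -> arc_length c = arc_length d.
Proof.
move=> cd; rewrite !arc_lengthE; congr ereal_sup; apply/seteqP.
by split => x [s hs <-]; exists s => //; rewrite (vsum_chord_ext cd hs).
Qed.

Lemma arc_length_ge0 n (c : R -> 'rV[R[i]]_n) : (0 <= arc_length c)%E.
Proof.
apply: le_trans (vsum_le_arc_length c (itv_partition1 ltr01)).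
by rewrite lee_fin vsum_chord_ge0.
Qed.

Lemma lee_mul_add1 (x L : \bar R) : (0 <= L)%E ->
  (forall e : R, 0 < e -> (x <= (1 + e)%:E * L)%E) -> (x <= L)%E.
Proof.
case: L => [l|_ _|] //; last by rewrite leey.
rewrite lee_fin => l0 h; apply/lee_addgt0Pr => e e0.
have l1 : 0 < l + 1 by rewrite ltr_wpDl.
apply: (le_trans (h _ (divr_gt0 e0 l1))).
rewrite -EFinM -EFinD lee_fin mulrDl mul1r lerD2l mulrAC ler_pdivrMr//.
by rewrite ler_pM2l// lerDl.
Qed.

End Comparison.

(** * The completion is bilipschitz *)

Section Completion.
Local Open Scope complex_scope.
Context {R : realType}.

(** The origin is the image of points that are arbitrarily close to 0. *)
Lemma small_images_fix_origin N k (Xbar : set 'rV[R[i]]_N) (XG : set 'rV[R[i]]_k)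
    (G : 'rV[R[i]]_N -> 'rV[R[i]]_k) :
  XG 0 -> {for 0, continuous G} ->
  on_small_representatives Xbar XG (fun A B => G @` A = B) -> G 0 = 0.
Proof.
move=> XG0 cG small; apply: enorm_eq0; apply/le_anti; rewrite enorm_ge0 andbT.
apply/ler_addgt0Pl => e e0; rewrite addr0.
move/cvg_enormP : cG => /(_ _ e0)/small[W [W' [_ WO [_ W'0] E]]].
have : (XG `&` W') 0 by [].
rewrite -E => -[x [_ /WO Wx] Gx].
by move: Wx; rewrite /= Gx sub0r enormN => /ltW.
Qed.

(** The image of [A `&` W] is the preimage of [W] under the continuous inverse. *)
Lemma relatively_open_image N k (A : set 'rV[R[i]]_N) (B : set 'rV[R[i]]_k)
    (G : 'rV[R[i]]_N -> 'rV[R[i]]_k) (W : set 'rV[R[i]]_N) :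
  homeomorphism G A B -> open W ->
  exists2 V, open V & G @` (A `&` W) = B `&` V.
Proof.
move=> [_ GA [ginv [ginvc ginvK]]] oW.
have /open_subspaceP[V oV EV] := (continuousP _).1 ginvc W oW.
exists V => //; rewrite [RHS]setIC EV; apply/seteqP; split => [_ [x [Ax Wx] <-]|y [/= Wy By]].
  have Wgx : W (ginv (G x)) by rewrite ginvK.
  by split; [exact: Wgx|rewrite -GA; exists x].
move: By; rewrite -GA => -[x Ax xy]; exists x => //; split => //.
have {}Wy : W (ginv y) by exact: Wy.
by move: Wy; rewrite -xy ginvK.
Qed.

Lemma homeomorphism_sub N k (A A' : set 'rV[R[i]]_N) (B B' : set 'rV[R[i]]_k)
    (G : 'rV[R[i]]_N -> 'rV[R[i]]_k) :
  A' `<=` A -> G @` A' = B' -> homeomorphism G A B -> homeomorphism G A' B'.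
Proof.
move=> AA GA' [Gc GA [ginv [ginvc ginvK]]]; split => //.
  exact: continuous_subspaceW Gc.
exists ginv; split; last by move=> x /AA; exact: ginvK.
by apply: continuous_subspaceW ginvc => y; rewrite -GA' -GA => -[x /AA Ax <-]; exists x.
Qed.

Section Distances.
Variables (N k m : nat) (X W : set 'rV[R[i]]_N) (Y : set 'rV[R[i]]_m).
Variables (F : 'rV[R[i]]_N -> 'rV[R[i]]_k) (G : 'rV[R[i]]_N -> 'rV[R[i]]_m).
Hypothesis hF : forall p, W p -> holomorphic_at F p.
Hypothesis hG : forall p, W p -> holomorphic_at G p.

(** The image by [G] of a path in [X `&` W] is at most [C] times longer for the
    Euclidean metric, since velocities are tangent to [X]. *)
Lemma inner_dist_le_metric_dist (C : R) p q : 0 < C ->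
  (forall p, X p -> W p -> p != 0 -> forall u, tangent_space X p u ->
    enorm ('d G p u) <= C * enorm ('d F p u)) ->
  G @` (X `&` W) `<=` Y ->
  (C^-1%:E * inner_dist Y (G p) (G q) <= metric_dist F (X `&` W) p q)%E.
Proof.
move=> C0 GC GY; apply: le_ereal_inf_tmp => _ [c [[cc c0 c1 cX] cpw] <-].
have cXW t : 0 <= t <= 1 -> (X `&` W) (c t) by move=> t01; apply: cX; rewrite /= in_itv.
have path : path_in Y (G p) (G q) (G \o c)%FUN.
  split; [|by rewrite /= c0|by rewrite /= c1|].
    apply/within_continuous_enormP => t; rewrite /= in_itv/= => t01 e e0.
    have [_ Wt] := cXW t t01.
    have /cvg_enormP/(_ _ e0)/nbhs_enormP[d d0 hd] := holomorphic_at_continuous (hG Wt).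
    move/within_continuous_enormP : cc => /(_ t).
    rewrite /= in_itv/= => /(_ t01 _ d0); apply: filterS => y h yt.
    by apply: hd; exact: h.
  by move=> t; rewrite /= ?in_itv/= => t01; apply: GY; exists (c t); [exact: cXW|].
have len : (arc_length (G \o c)%FUN <= C%:E * metric_length F c)%E.
  apply: arc_length_le_metric_length => //.
  - exact: ltW.
  - by move=> a b a0 ab b1 nz; apply: piecewise_C1_pwC1 => //; exact: cpw.
  - by move=> t /cXW[_]; exact: hF.
  - by move=> t /cXW[_]; exact: hG.
  - move=> t v t01 ct hv.
    have t01' : 0 <= t <= 1 by case/andP: t01 => /ltW -> /ltW ->.
    have [Xt Wt] := cXW t t01'.
    apply: GC => //; apply: velocity_tangent hv.
    have tI : t \in `]0, 1[%R by rewrite in_itv.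
    have := near_in_itvoo tI; apply: filterS => s; rewrite in_itv/= => /andP[/ltW s0 /ltW s1].
    by have [] := cXW s; first by rewrite s0.
have Ci : (0 <= C^-1%:E)%E by rewrite lee_fin invr_ge0 ltW.
apply: (@le_trans _ _ (C^-1%:E * arc_length (G \o c)%FUN)%E).
  by apply: lee_wpmul2l => //; apply: ereal_inf_lbound; exists (G \o c)%FUN.
apply: (@le_trans _ _ (C^-1%:E * (C%:E * metric_length F c))%E).
  exact: lee_wpmul2l.
by rewrite muleA -EFinM mulVf ?mul1e// lt0r_neq0.
Qed.

(** A path in [Y] is lifted by the inverse of [G], and the lift is replaced by paths
    that are piecewise C^1 off the origin and hardly longer. *)
Lemma metric_dist_le_inner_dist p q : open W ->
  (forall p u, W p -> enorm ('d F p u) <= enorm ('d G p u)) ->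
  (forall p, X p -> W p -> p != 0 -> regular_at X p) ->
  (forall p, X p -> W p -> p != 0 ->
    forall u, tangent_space X p u -> 'd G p u = 0 -> u = 0) ->
  homeomorphism G (X `&` W) Y -> (X `&` W) p -> (X `&` W) q ->
  (metric_dist F (X `&` W) p q <= inner_dist Y (G p) (G q))%E.
Proof.
move=> oW FG Xreg Gimm [_ GXY [ginv [ginvc ginvK]]] Xp Xq.
apply: le_ereal_inf_tmp => _ [gam [gamc gam0 gam1 gamY] <-].
have ginvY y : Y y -> (X `&` W) (ginv y) /\ G (ginv y) = y.
  by rewrite -GXY => -[x Xx <-]; rewrite ginvK.
pose c0 := (ginv \o gam)%FUN.
have gY t : 0 <= t <= 1 -> Y (gam t) by move=> t01; apply: gamY; rewrite /= in_itv.
have c0c : {within `[0, 1], continuous c0}.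
  apply/within_continuous_enormP => t; rewrite /= in_itv/= => t01 e e0.
  move/within_continuous_enormP : ginvc => /(_ _ (gY t t01) e e0).
  move=> /nbhs_enormP[d d0 hd].
  move/within_continuous_enormP : gamc => /(_ t).
  rewrite /= in_itv/= => /(_ t01 _ d0); apply: filterS => s h sI.
  apply: hd; first exact: h.
  by apply: gY; move: sI; rewrite /= in_itv.
have c0X t : 0 <= t <= 1 -> X (c0 t) /\ W (c0 t) by move=> /gY/ginvY[].
apply: (lee_mul_add1 (arc_length_ge0 _)) => e e0.
have [c [path pw len]] := exists_short_path oW hF hG FG Xreg Gimm c0c c0X e0.
apply: (@le_trans _ _ (metric_length F c)).
  have E0 : c0 0 = p by rewrite /c0 /= gam0 ginvK.
  have E1 : c0 1 = q by rewrite /c0 /= gam1 ginvK.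
  rewrite E0 E1 in path.
  by apply: ereal_inf_lbound; exists c; [split; [exact: path|exact: pw]|reflexivity].
apply: (le_trans len); rewrite (@arc_length_ext _ _ (G \o c0)%FUN gam); first by [].
by move=> t t01; rewrite /c0 /=; have [] := ginvY _ (gY t t01).
Qed.

End Distances.

End Completion.

(* The bilipschitz property is stated, with uniform constants, for the relatively
   open subsets of a small representative: in particular for every smaller
   representative, and for it with the origin removed. *)
Theorem proposition5p5 (R : realType) (N k r : nat)
    (Xbar : set 'rV[R[i]]_N) (X : set 'rV[R[i]]_k)
    (F : 'rV[R[i]]_N -> 'rV[R[i]]_k) (g : 'rV[R[i]]_N -> 'rV[R[i]]_r)
    (XG : set 'rV[R[i]]_(k + r))
    (normal_Xbar : normal_surface_germ Xbar)
    (surface_X : surface_germ X)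
    (normalization_X : normalization Xbar X F)
    (non_pinched_X : immersion_off0 Xbar F)
    (completion_F : completion Xbar (pullback_maximal_ideal Xbar F) F g XG) :
  let G := pair_map F g in
  exists (W0 : set 'rV[R[i]]_N) (K : R),
    [/\ open W0 /\ W0 0,
        0 < K,
        forall p, Xbar p -> W0 p -> p != 0 ->
          forall u, tangent_space Xbar p u ->
            K * enorm ('d G p u) <= pullback_norm F p u /\
            pullback_norm F p u <= enorm ('d G p u)
      & forall W : set 'rV[R[i]]_N, open W -> W `<=` W0 ->
          exists W' : set 'rV[R[i]]_(k + r),
            [/\ open W', (W 0 -> W' 0),
                homeomorphism G (Xbar `&` W) (XG `&` W')
              & forall p q, (Xbar `&` W) p -> (Xbar `&` W) q ->
                  (K%:E * inner_dist (XG `&` W') (G p) (G q)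
                     <= metric_dist F (Xbar `&` W) p q)%E /\
                  (metric_dist F (Xbar `&` W) p q
                     <= inner_dist (XG `&` W') (G p) (G q))%E]].
Proof.
move=> G.
have [[Xbar0 _ _ _] _ Xbar_iso] := normal_Xbar.
have [[scF scG] lam _ [[XG0 _ _ _] _] small] := completion_F.
have [_ [hG0 _] immG] := scG; have [_ [hF0 _] _] := scF.
have [lambda hlambda] := choice lam.
(* A bound for the finitely many coefficients near 0. *)
pose M := \big[Num.max/0]_(j < k + r) \big[Num.max/0]_(i < k) (normc (lambda j i 0) + 1).
have hM j i : \forall p \near (0 : 'rV[R[i]]_N), normc (lambda j i p) <= M.
  have := holomorphic_at_bounded ((hlambda j).1 i); apply: filterS => p /le_trans; apply.
  by rewrite /M (le_trans _ (le_bigmax _ _ j))//= (le_bigmax _ (fun i => normc (lambda j i 0) + 1) i).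
pose C := \sum_(j < k + r) \sum_(i < k) M + 1.
have M0 : 0 <= M by exact: bigmax_ge_id.
have C0 : 0 < C by rewrite ltr_wpDl// sumr_ge0// => j _; rewrite sumr_ge0.
have nF : \forall p \near (0 : 'rV[R[i]]_N), holomorphic_at F p by exact: holomorphic_at_near.
have nG : \forall p \near (0 : 'rV[R[i]]_N), holomorphic_at G p by exact: holomorphic_at_near.
have nlam : \forall p \near (0 : 'rV[R[i]]_N), forall j, Xbar p -> p != 0 ->
    forall u, tangent_space Xbar p u ->
    'd (Defs.coord G j) p u = \sum_(i < k) lambda j i p * 'd (Defs.coord F i) p u.
  apply: (@filter_forall _ 'I_(k + r) _ (nbhs (0 : 'rV[R[i]]_N))) => j.
  exact: (hlambda j).2.
have nM : \forall p \near (0 : 'rV[R[i]]_N), forall j i, normc (lambda j i p) <= M.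
  apply: (@filter_forall _ 'I_(k + r) _ (nbhs (0 : 'rV[R[i]]_N))) => j.
  by apply: (@filter_forall _ 'I_k _ (nbhs (0 : 'rV[R[i]]_N))) => i; exact: hM.
pose good := [set p : 'rV[R[i]]_N | [/\ holomorphic_at F p, holomorphic_at G p,
   Xbar p -> p != 0 -> regular_at Xbar p,
   Xbar p -> p != 0 -> forall u, tangent_space Xbar p u -> 'd G p u = 0 -> u = 0
   & Xbar p -> p != 0 -> forall u, tangent_space Xbar p u ->
      enorm ('d G p u) <= C * enorm ('d F p u)]].
have ngood : nbhs (0 : 'rV[R[i]]_N) good.
  near=> p.
  have hFp : holomorphic_at F p by near: p.
  have hGp : holomorphic_at G p by near: p.
  split.
  - exact: hFp.
  - exact: hGp.
  - by near: p.
  - by near: p.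
  - move=> Xp p0 u tu.
    have dF := holomorphic_at_differentiable hFp.
    have dG := holomorphic_at_differentiable hGp.
    have hMp : forall j i, normc (lambda j i p) <= M by near: p.
    have hl : forall j, 'd (Defs.coord G j) p u =
        \sum_(i < k) lambda j i p * 'd (Defs.coord F i) p u.
      by move=> j; move: j Xp p0 u tu {dF dG}; near: p.
    apply: (@le_trans _ _ ((\sum_(j < k + r) \sum_(i < k) M) * enorm ('d F p u))).
      apply: (enorm_le_combination hMp) => j.
      rewrite -(diff_coord j u dG) hl; apply: eq_bigr => i _.
      by rewrite (diff_coord i u dF).
    by rewrite ler_wpM2r ?enorm_ge0// lerDl.
have [W0 [W0' [[oW0 W00] W0good [oW0' W0'0] [homG _]]]] := small good ngood.
have hF p : W0 p -> holomorphic_at F p by move=> /W0good[].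
have hG p : W0 p -> holomorphic_at G p by move=> /W0good[].
have FG p u : W0 p -> enorm ('d F p u) <= enorm ('d G p u).
  move=> W0p; apply: enorm_diff_pair.
    exact: holomorphic_at_differentiable (hF p W0p).
  exact: holomorphic_at_differentiable (hG p W0p).
have GC p : Xbar p -> W0 p -> p != 0 -> forall u, tangent_space Xbar p u ->
    enorm ('d G p u) <= C * enorm ('d F p u).
  by move=> Xp /W0good[_ _ _ _ h] p0; exact: h.
have G0 : G 0 = 0.
  apply: (small_images_fix_origin (Xbar := Xbar) XG0).
    exact: holomorphic_at_continuous hG0.
  move=> V /small[W [W' [h1 h2 h3 [[_ h4 _] _]]]].
  by exists W, W'; split.
exists W0, C^-1; split.
- by split.
- by rewrite invr_gt0.
- move=> p Xp W0p p0 u tu; split; last exact: FG.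
  by rewrite ler_pdivrMl//; exact: GC.
- move=> W oW WW0.
  have [V oV GV] := relatively_open_image homG oW.
  exists (W0' `&` V).
  have GW : G @` (Xbar `&` W) = XG `&` (W0' `&` V).
    rewrite setIA -GV -setIA; congr (_ @` (_ `&` _)).
    by rewrite setIC; apply/esym/setIidl.
  have hW p : W p -> W0 p by exact: WW0.
  have homW : homeomorphism G (Xbar `&` W) (XG `&` (W0' `&` V)).
    by apply: homeomorphism_sub GW homG => p [Xp /hW W0p].
  have hFW p : W p -> holomorphic_at F p by move=> /hW/hF.
  have hGW p : W p -> holomorphic_at G p by move=> /hW/hG.
  split.
  + exact: openI.
  + move=> W00'; have : (G @` (Xbar `&` W)) 0 by exists 0.
    by rewrite GW => -[].
  + exact: homW.
  + move=> p q Xp Xq; split.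
      apply: (inner_dist_le_metric_dist hFW hGW _ _ C0).
        by move=> x Xx /hW Wx; exact: GC.
      by rewrite GW.
    apply: (metric_dist_le_inner_dist hFW hGW oW _ _ _ homW Xp Xq).
    * by move=> x u /hW; exact: FG.
    * by move=> x Xx /hW/W0good[_ _ h _ _]; exact: h.
    * by move=> x Xx /hW/W0good[_ _ _ h _]; exact: h.
Unshelve. all: by end_near. Qed.
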